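(* Let $0<p<q\le\infty$. Then every $K$-monotone quasi-Banach sequence lattice $X$ with respect to the couple $(l^p,l^q)$ is a $K$-space, i.e., $X=(l^p,l^q)_{E:K}$ (with equivalent quasi-norms) for some quasi-Banach lattice $E\in Int(\overline{L^\infty})$. If additionally $q\ge 1$, the same holds for every quasi-Banach sequence lattice $X$ such that $X\in Int(l^p,l^q)$.
   Context: $l^p$, $0<p\le\infty$, is the usual space of real sequences indexed by $\mathbb{N}$ with quasi-norm $(\sum|x_k|^p)^{1/p}$ ($\sup|x_k|$ if $p=\infty$). A quasi-Banach sequence lattice is a quasi-Banach space $X$ of real sequences (coordinatewise order) such that $x\in X$, $|y|\le|x|$ imply $y\in X$, $\|y\|_X\le\|x\|_X$. For a couple $\overline{X}=(X_0,X_1)$ of quasi-Banach spaces: $\Delta(\overline X)=X_0\cap X_1$ and $\Sigma(\overline X)=X_0+X_1$ have quasi-norms $\max(\|x\|_{X_0},\|x\|_{X_1})$ and $\inf\{\|x_0\|_{X_0}+\|x_1\|_{X_1}:x=x_0+x_1\}$; $K(t,x;\overline{X})=\inf\{\|x_0\|_{X_0}+t\|x_1\|_{X_1}:x=x_0+x_1,\ x_i\in X_i\}$. $X$ is intermediate if $\Delta(\overline X)\subset X\subset\Sigma(\overline X)$ continuously. $Int(\overline X)=Int(X_0,X_1)$ is the collection of interpolation spaces: intermediate quasi-Banach spaces $X$ such that every linear operator $T:\Sigma(\overline X)\to\Sigma(\overline X)$ bounded on $X_0$ and on $X_1$ is bounded on $X$. An intermediate $X$ is $K$-monotone with respect to $\overline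 X$ if $x\in X$, $y\in\Sigma(\overline X)$ and $K(t,y;\overline X)\le K(t,x;\overline X)$ for all $t>0$ imply $y\in X$. $\overline{L^\infty}=(L^\infty,L^\infty(1/t))$ is the couple on $(0,\infty)$ (Lebesgue measure) with norms $\operatorname{ess\,sup}|f(t)|$ and $\operatorname{ess\,sup}|f(t)|/t$. For a quasi-Banach function lattice $E$ on $(0,\infty)$ with $E\in Int(\overline{L^\infty})$, $\overline{X}_{E:K}$ is the space of $x\in\Sigma(\overline X)$ with $\|x\|=\|K(\cdot,x;\overline X)\|_E<\infty$. *)

(* Defs.v *)
From HB Require Import structures.
From mathcomp Require Import all_boot all_order all_algebra.
From mathcomp Require Import all_classical all_reals all_analysis measurable_realfun.

Set Implicit Arguments.
Unset Strict Implicit.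
Unset Printing Implicit Defensive.

Import Order.TTheory GRing.Theory Num.Theory.
Import numFieldNormedType.Exports.

Local Open Scope classical_set_scope.
Local Open Scope ring_scope.

Section L0.
Context d (T : measurableType d) (R : realType).
Variable mu : {measure set T -> \bar R}.

Definition L0 : Type := {mfun_ mu, T >-> R}.

HB.instance Definition _ := Choice.on L0.

Definition toL0 (f : {mfun T >-> R}) : L0 :=
  \pi_({mfun_ mu, T >-> R})%qT f.

Definition L0_fun (f : L0) : {mfun T >-> R} := repr f.

Lemma toL0P (f g : {mfun T >-> R}) : toL0 f = toL0 g <-> f = g %[ae mu].
Proof.
by split=> [/eqP|fg]; [rewrite eqmodE => /asboolP|
  apply/eqP; rewrite eqmodE; exact/asboolP].
Qed.

Lemma L0_funK (f : L0) : toL0 (L0_fun f) = f.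
Proof. exact: reprK. Qed.

Lemma toL0K (f : {mfun T >-> R}) : L0_fun (toL0 f) = f %[ae mu].
Proof. by apply/toL0P; rewrite L0_funK. Qed.

Definition L0_zero : L0 := toL0 0.
Definition L0_opp (f : L0) : L0 := toL0 (- L0_fun f).
Definition L0_add (f g : L0) : L0 := toL0 (L0_fun f + L0_fun g).
Definition L0_scale (a : R) (f : L0) : L0 := toL0 (a *: L0_fun f).

Lemma toL0_opp f : L0_opp (toL0 f) = toL0 (- f).
Proof.
apply/toL0P; apply: filterS (toL0K f) => t fE _.
by rewrite !mfunN /= fE.
Qed.

Lemma toL0_add f g : L0_add (toL0 f) (toL0 g) = toL0 (f + g).
Proof.
apply/toL0P; apply: filterS2 (toL0K f) (toL0K g) => t fE gE _.
by rewrite !mfunD /= fE ?gE.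
Qed.

Lemma toL0_scale a f : L0_scale a (toL0 f) = toL0 (a *: f).
Proof.
apply/toL0P; apply: filterS (toL0K f) => t fE _.
have scaleE (g : {mfun T >-> R}) : (a *: g) t = a *: g t by [].
by rewrite !scaleE fE.
Qed.

Lemma L0_addA : associative L0_add.
Proof.
move=> f g h; rewrite -(L0_funK f) -(L0_funK g) -(L0_funK h) !toL0_add.
by rewrite addrA.
Qed.

Lemma L0_addC : commutative L0_add.
Proof. by move=> f g; rewrite /L0_add addrC. Qed.

Lemma L0_add0 : left_id L0_zero L0_add.
Proof. by move=> f; rewrite -(L0_funK f) toL0_add add0r. Qed.

Lemma L0_addN : left_inverse L0_zero L0_opp L0_add.
Proof. by move=> f; rewrite -(L0_funK f) toL0_opp toL0_add addNr. Qed.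

HB.instance Definition _ :=
  GRing.isZmodule.Build L0 L0_addA L0_addC L0_add0 L0_addN.

Lemma L0_scaleA a b f : L0_scale a (L0_scale b f) = L0_scale (a * b) f.
Proof. by rewrite -(L0_funK f) !toL0_scale scalerA. Qed.

Lemma L0_scale1 : left_id 1 L0_scale.
Proof. by move=> f; rewrite -(L0_funK f) toL0_scale scale1r. Qed.

Lemma L0_scaleDr : right_distributive L0_scale +%R.
Proof.
move=> a f g; rewrite -(L0_funK f) -(L0_funK g).
by rewrite [_ + _]toL0_add !toL0_scale [RHS]toL0_add scalerDr.
Qed.

Lemma L0_scaleDl f : {morph L0_scale^~ f : a b / a + b}.
Proof.
move=> a b /=; rewrite -(L0_funK f) !toL0_scale [RHS]toL0_add.
by rewrite scalerDl.
Qed.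

HB.instance Definition _ := GRing.Zmodule_isLmodule.Build R L0
  L0_scaleA L0_scale1 L0_scaleDr L0_scaleDl.

End L0.

(* A quasi-normed space is represented inside an ambient vector space V by its
   quasi-norm, extended by +oo outside the space: X = [set x | N x < +oo]. *)

Section quasi_normed.
Context (R : realType) (V : lmodType R).
Local Open Scope ereal_scope.
Implicit Types (N M NX : V -> \bar R) (x y : V) (T : V -> V).

Definition quasi_norm N : Prop :=
  [/\ forall x, 0 <= N x,
      forall x, N x = 0 -> x = 0%R,
      forall (a : R) x, N (a *: x)%R = `|a|%:E * N x &
      exists C : R, (1 <= C)%R /\ forall x y, N (x + y)%R <= C%:E * (N x + N y)].

Definition complete_qnorm N : Prop :=
  forall u : nat -> V,
    (forall n, N (u n) < +oo) ->
    (forall e : R, (0 < e)%R -> exists n0 : nat, forall m n : nat,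
        (n0 <= m)%N -> (n0 <= n)%N -> N (u m - u n)%R < e%:E) ->
    exists x, N x < +oo /\ N (u n - x)%R @[n --> \oo] --> 0.

Definition quasi_banach N : Prop := quasi_norm N /\ complete_qnorm N.

Definition embedded N M : Prop :=
  exists C : R, (0 < C)%R /\ forall x, M x <= C%:E * N x.

Definition equivalent_qnorm N M : Prop := embedded N M /\ embedded M N.

Definition delta_qnorm N0 N1 x : \bar R := maxe (N0 x) (N1 x).

Definition Kfun N0 N1 (t : R) x : \bar R :=
  ereal_inf [set r | exists x0 x1, [/\ N0 x0 < +oo, N1 x1 < +oo,
    x = (x0 + x1)%R & r = N0 x0 + t%:E * N1 x1]].

Definition sigma_qnorm N0 N1 x : \bar R :=
  ereal_inf [set r | exists x0 x1, [/\ N0 x0 < +oo, N1 x1 < +oo,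
    x = (x0 + x1)%R & r = N0 x0 + N1 x1]].

Definition intermediate N0 N1 NX : Prop :=
  embedded (delta_qnorm N0 N1) NX /\ embedded NX (sigma_qnorm N0 N1).

Definition bounded_on NX T : Prop :=
  exists C : R, (0 < C)%R /\ forall x, NX x < +oo -> NX (T x) <= C%:E * NX x.

(* T restricts to a linear operator from X to X; the values of T outside X are
   irrelevant. *)
Definition linear_operator_on NX T : Prop :=
  (forall x, NX x < +oo -> NX (T x) < +oo) /\
  (forall (a : R) x y, NX x < +oo -> NX y < +oo ->
     T (a *: x + y)%R = (a *: T x + T y)%R).

Definition interpolation_space N0 N1 NX : Prop :=
  [/\ quasi_banach NX, intermediate N0 N1 NX &
      forall T, linear_operator_on (sigma_qnorm N0 N1) T ->
        bounded_on N0 T -> bounded_on N1 T -> bounded_on NX T].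

Definition K_monotone N0 N1 NX : Prop :=
  intermediate N0 N1 NX /\
  forall x y, NX x < +oo -> sigma_qnorm N0 N1 y < +oo ->
    (forall t : R, (0 < t)%R -> Kfun N0 N1 t y <= Kfun N0 N1 t x) ->
    NX y < +oo.

End quasi_normed.

Section half_line.
Context (R : realType).
Local Open Scope ereal_scope.

Definition halfline_itv : interval R := `]0%R, +oo[.

Lemma measurable_halfline :
  measurable ([set` halfline_itv] : set (measurableTypeR R)).
Proof. exact: measurable_itv. Qed.

(* Lebesgue measure on (0, +oo), as a measure on the line that does not charge
   the rest; functions on (0, +oo) modulo equality a.e. are thus L0 of it. *)
Definition halfline_measure : {measure set (measurableTypeR R) -> \bar R} :=
  mrestr (@lebesgue_measure R) measurable_halfline.

Definition halfline_L0 : lmodType R := L0 halfline_measure.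

Implicit Types (f g : halfline_L0) (NE : halfline_L0 -> \bar R).

Definition Linfty_qnorm f : \bar R :=
  'N[halfline_measure]_+oo [EFin \o L0_fun f].

Definition Linfty_inv_qnorm f : \bar R :=
  'N[halfline_measure]_+oo [(fun t => (L0_fun f t / t)%:E)].

Definition function_lattice NE : Prop :=
  quasi_banach NE /\
  forall f g, (\forall t \ae halfline_measure,
      (`|L0_fun g t| <= `|L0_fun f t|)%R) -> NE g <= NE f.

(* For x in the sum of the couple, K(., x) is finite and nondecreasing, hence
   defines exactly one class f, and the infimum below is NE f; for x outside
   the sum, no class qualifies and the infimum is +oo. *)
Definition EK_qnorm (V : lmodType R) (N0 N1 : V -> \bar R) NE (x : V) : \bar R :=
  ereal_inf [set NE f | f in [set f : halfline_L0 | \forall t \ae halfline_measure,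
    (L0_fun f t)%:E = Kfun N0 N1 t x]].

Definition K_space (V : lmodType R) (N0 N1 NX : V -> \bar R) : Prop :=
  exists NE, [/\ function_lattice NE,
    interpolation_space Linfty_qnorm Linfty_inv_qnorm NE &
    equivalent_qnorm NX (EK_qnorm N0 N1 NE)].

End half_line.

Section sequences.
Context (R : realType).
Local Open Scope ereal_scope.

(* For p = +oo the essential supremum is the supremum, only the empty set being
   negligible for the counting measure. *)
Definition lp_qnorm (p : \bar R) (x : nat -> R) : \bar R :=
  'N[counting]_p [EFin \o x].

Definition sequence_lattice (NX : (nat -> R) -> \bar R) : Prop :=
  quasi_banach NX /\
  forall x y, (forall k, (`|y k| <= `|x k|)%R) -> NX y <= NX x.

End sequences.

(* Main.v *)
Require Import Defs.
From HB Require Import structures.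
From mathcomp Require Import all_boot all_order all_algebra.
From mathcomp Require Import all_classical all_reals all_analysis.
From mathcomp Require Import ess_sup_inf measurable_realfun.
From mathcomp Require Import lra ring zify.
Import Order.TTheory GRing.Theory Num.Theory.
Import numFieldNormedType.Exports.

(** Both parts rest on the explicit structure of lattices of sequences.

    For a K-monotone lattice [X], the parameter space [E] consists of the functions
    on the half-line that are dominated by [K(., x)] for some [x] in [X], with the
    least [NX x] as quasi-norm ([E_qnorm]). It is a quasi-normed lattice because
    [K(., x) + K(., y) <= 2 K(., |x| + |y|)] in a couple of lattices ([dominatedD]).
    It is complete ([E_qnorm_complete]) because, for countably many [x k], the geometric
    weights in [K(., x k) <= 2 ^- k K(., 2 ^ k x k)] make the series of the K-functionals
    converge. It is an interpolation space for the couple of weighted [L^oo] spaces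
    ([E_interpolation]) because [K(., x)] is quasi-concave, so that a function below it
    can be cut at any point into two pieces of the right size. If [K(., x)]
    is in [E], it is below [K(., y)] for some [y] in [X], and K-monotonicity puts [x]
    in [X]. The equivalence of the quasi-norms requires a bound in the definition of
    K-monotonicity, which a gliding hump argument provides ([K_monotone_bound]).

    For the second part, interpolation spaces are shown to be K-monotone. Let
    [K(., y) <= K(., x)]. After an approximate decreasing rearrangement
    ([almost_sorted]), both sequences may be taken nonincreasing. Then the K-functional
    at [t = n ^ (1 / p - 1 / q)] is equivalent to the sum of the [l^p] quasi-norm of the
    first [n] entries and of [t] times the [l^q] quasi-norm of the others
    ([power_sum_transfer]). Distinguishing at each [n] which of the two terms dominates
    for [x], one cuts [y] into a part [u] whose partial sums of [p]-th powers are below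
    those of [x], and a part [v] whose tail sums of [q]-th powers are below those of
    [x] ([sorted_act_finite]). Each part is the image of [x] under operators bounded on
    both spaces: [u] by attaching each of its entries to a single entry of [x], which is
    a bin packing problem ([head_assignment], [head_majorized_act]), and [v] by attaching
    to each of its entries a block of entries of [x] ([tail_block_sum],
    [tail_majorized_act]). Only the latter uses [q >= 1], for the boundedness of averages
    on [l^q]; for [q = +oo] the part [v] does not occur ([sorted_act_infty]). *)

Set Implicit Arguments.
Unset Strict Implicit.
Unset Printing Implicit Defensive.
Local Open Scope classical_set_scope.
Local Open Scope ring_scope.

(** * The quasi-norms of the sequence spaces *)
Section lp_norm.
Context (R : realType).
Implicit Types (p q : \bar R) (x y : nat -> R) (c : R).

(** The bound [lp_qnorm p x <= c] without series and essential suprema: all later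
    estimates are made on finite sums of real numbers, through [lp_leP]. *)
Definition lp_le p x c : Prop :=
  if p is r%:E then forall n, \sum_(0 <= k < n) `|x k| `^ r <= c `^ r
  else forall k, `|x k| <= c.

Lemma powR_le (r a b : R) : 0 < r -> 0 <= a -> 0 <= b ->
  (a `^ r <= b `^ r) = (a <= b).
Proof.
move=> r0 a0 b0; apply/idP/idP => [|ab]; last first.
  by apply: ge0_ler_powR => //; exact: ltW.
move=> ab; rewrite -[a]powRr1// -[b]powRr1// -(mulfV (lt0r_neq0 r0)) !powRrM.
by apply: ge0_ler_powR; rewrite ?nnegrE ?powR_ge0// invr_ge0 ltW.
Qed.

Lemma nneseries_leP (u : nat -> R) (M : R) : (forall k, 0 <= u k) ->
  (\sum_(0 <= k <oo) (u k)%:E <= M%:E)%E <->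
  forall n, \sum_(0 <= k < n) u k <= M.
Proof.
move=> u0; split=> [uM n|uM].
  rewrite -lee_fin -sumEFin; apply: le_trans uM.
  by apply: nneseries_lim_ge => k _ _; rewrite lee_fin.
apply: lime_le; first by apply: is_cvg_nneseries => k _ _; rewrite lee_fin.
by apply: nearW => n; rewrite sumEFin lee_fin.
Qed.

Lemma counting_eq0 (A : set nat) : counting A = 0%E :> \bar R -> A = set0.
Proof.
rewrite /counting; case: asboolP => [fA|_ //] /eqP; rewrite eqe pnatr_eq0.
by rewrite finmap.cardfs_eq0 => /eqP /fset_set_set0 ->.
Qed.

(** For the counting measure only the empty set is negligible, so that the essential
    supremum is a supremum; for a real exponent, a series of nonnegative terms is
    bounded as soon as its partial sums are. *)
Lemma lp_leP p x c : (0 < p)%E -> 0 <= c -> (lp_qnorm p x <= c%:E)%E <-> lp_le p x c.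
Proof.
case: p => [r||]//; last first.
  move=> _ c0; rewrite /lp_qnorm unlock /=.
  have -> : (0 < (counting : {measure set nat -> \bar R}) setT)%E.
    rewrite lt0e measure_ge0 andbT; apply/eqP => /counting_eq0 /seteqP[+ _].
    by move=> /(_ 0%N); apply.
  split=> [/ess_supP[N [mN /counting_eq0 N0 sN]] k|xc].
    apply: contrapT => xk; suff : N k by rewrite N0.
    by apply: sN => /=; rewrite lee_fin.
  by apply/ess_supP; apply: nearW => k /=; rewrite lee_fin.
rewrite lte_fin => r0 c0; rewrite /lp_qnorm Lnorm_counting// /lp_le.
rewrite (@eq_eseriesr _ _ (fun k => (`|x k| `^ r)%:E)); last first.
  by move=> k _; rewrite /= ?abse_EFin ?poweR_EFin.
have h0 k : 0 <= `|x k| `^ r by exact: powR_ge0.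
rewrite -(nneseries_leP _ h0).
set S := (\sum_(0 <= k <oo) _)%E.
have S0 : (0 <= S)%E by apply: nneseries_ge0 => k _ _; rewrite lee_fin.
clearbody S; case: S S0 => [s||]// s0; last first.
  by rewrite poweRyr ?invr_eq0 ?gt_eqF// !leye_eq.
rewrite poweR_EFin !lee_fin; rewrite lee_fin in s0.
rewrite -[in X in _ <-> X](powRr1 s0) -(mulVf (lt0r_neq0 r0)) powRrM.
by rewrite powR_le ?powR_ge0//.
Qed.

Lemma ge0_is_fin_num (a : \bar R) : (0 <= a)%E -> (a < +oo)%E ->
  exists2 c : R, 0 <= c & a = c%:E.
Proof. by case: a => [c||]// c0 _; exists c. Qed.

Lemma lp_le_root (r M : R) x : 0 < r -> 0 <= M ->
  (forall n, \sum_(0 <= k < n) `|x k| `^ r <= M) -> lp_le r%:E x (M `^ r^-1).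
Proof.
by move=> r0 M0 H n; rewrite -powRrM mulVf ?lt0r_neq0// powRr1.
Qed.

Lemma lp_qnorm_ge0 p x : (0 <= lp_qnorm p x)%E.
Proof. exact: Lnorm_ge0. Qed.

Lemma lp_le_qnorm p x : (0 < p)%E -> (lp_qnorm p x < +oo)%E ->
  exists2 c, 0 <= c & lp_qnorm p x = c%:E /\ lp_le p x c.
Proof.
move=> p0 /(ge0_is_fin_num (lp_qnorm_ge0 p x))[c c0 xc]; exists c => //.
by split=> //; apply/lp_leP; rewrite ?xc.
Qed.

Lemma lp_qnorm_le p q (C : R) x y : (0 < p)%E -> (0 < q)%E -> 0 < C ->
  (forall c, 0 <= c -> lp_le p x c -> lp_le q y (C * c)) ->
  (lp_qnorm q y <= C%:E * lp_qnorm p x)%E.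
Proof.
move=> p0 q0 C0 H; have [xfin|] := ltP (lp_qnorm p x) +oo%E; last first.
  by rewrite leye_eq => /eqP ->; rewrite gt0_muley ?lte_fin// leey.
have [c c0 [-> xc]] := lp_le_qnorm p0 xfin.
by rewrite -EFinM; apply/lp_leP => //; [rewrite mulr_ge0// ltW|exact: H].
Qed.

Lemma lp_le_coord p x c k : (0 < p)%E -> 0 <= c -> lp_le p x c -> `|x k| <= c.
Proof.
case: p => [r||]// r0 c0 H.
rewrite lte_fin in r0; rewrite -(powR_le r0)//; apply: le_trans (H k.+1).
by rewrite big_nat_recr//= lerDr; apply: sumr_ge0 => i _; exact: powR_ge0.
Qed.

Lemma lp_coord p x k : (0 < p)%E -> (`|x k|%:E <= lp_qnorm p x)%E.
Proof.
move=> p0; have [xfin|] := ltP (lp_qnorm p x) +oo%E; last first.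
  by rewrite leye_eq => /eqP ->; rewrite leey.
have [c c0 [-> xc]] := lp_le_qnorm p0 xfin.
by rewrite lee_fin; apply: lp_le_coord xc.
Qed.

Lemma lp_le_mono p x y c : (0 < p)%E -> 0 <= c -> (forall k, `|y k| <= `|x k|) ->
  lp_le p x c -> lp_le p y c.
Proof.
case: p => [r||]// r0 c0 yx H; last by move=> k; apply: le_trans (yx k) (H k).
rewrite lte_fin in r0; move=> n; apply: le_trans (H n).
by apply: ler_sum => k _; rewrite powR_le.
Qed.

Lemma lp_mono p x y : (0 < p)%E -> (forall k, `|y k| <= `|x k|) ->
  (lp_qnorm p y <= lp_qnorm p x)%E.
Proof.
move=> p0 yx; rewrite -[leRHS]mul1e; apply: lp_qnorm_le => // c c0.
by rewrite mul1r; exact: lp_le_mono.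
Qed.

Lemma lp_le_scale p x c (a : R) : 0 <= c -> lp_le p x c -> lp_le p (a *: x) (`|a| * c).
Proof.
case: p => [r||] c0 H /=; last 2 first.
- by move=> k; rewrite normrM ler_wpM2l.
- by move=> k; rewrite normrM ler_wpM2l.
move=> n; rewrite powRM//; under eq_bigr do rewrite normrM powRM//.
by rewrite -mulr_sumr ler_wpM2l ?powR_ge0.
Qed.

Lemma lp_scale p x (a : R) : (0 < p)%E ->
  (lp_qnorm p (a *: x)%R <= `|a|%:E * lp_qnorm p x)%E.
Proof.
move=> p0; have [->|a0] := eqVneq a 0.
  rewrite normr0 mul0e scale0r; apply/lp_leP => //.
  case: p p0 => [r||]// r0; last by move=> k; rewrite normr0.
  rewrite lte_fin in r0; move=> n; rewrite big1 ?powR_ge0// => k _.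
  by rewrite normr0 powR0// gt_eqF.
by apply: lp_qnorm_le; rewrite ?normr_gt0// => c; exact: lp_le_scale.
Qed.

Lemma lp_delta p : (0 < p)%E -> (lp_qnorm p (fun k => (k == 0%N)%:R) <= 1%:E)%E.
Proof.
move=> p0; apply/lp_leP => //; case: p p0 => [r||]// r0; last first.
  by move=> k; rewrite normr_nat; case: (k == 0%N).
rewrite lte_fin in r0; move=> [|n]; first by rewrite big_geq ?powR_ge0.
rewrite big_nat_recl//= big1 ?addr0 ?normr1// => k _.
by rewrite normr0 powR0// gt_eqF.
Qed.

Lemma powRD_ge0 (c r s : R) : 0 <= c -> 0 < r -> 0 <= s -> c `^ (r + s) = c `^ r * c `^ s.
Proof.
move=> c0 r0 s0; have [->|cn0] := eqVneq c 0; last by rewrite powRD ?cn0 ?implybT.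
by rewrite (powR0 (lt0r_neq0 r0)) mul0r powR0// gt_eqF// ltr_wpDr.
Qed.

(** Since all entries are at most [c], the factor [|x k| ^ (q - p)] that separates the
    two powers is at most [c ^ (q - p)]. *)
Lemma lp_le_embed p q x c : (0 < p)%E -> (p <= q)%E -> 0 <= c ->
  lp_le p x c -> lp_le q x c.
Proof.
case: p => [r||]// r0 rq c0 H; last by case: q rq.
have xc k : `|x k| <= c by apply: lp_le_coord H.
case: q rq => [s||]// rs; rewrite lte_fin in r0; rewrite lee_fin in rs.
move=> n; rewrite -(subrK r s) addrC; set d := s - r.
have d0 : 0 <= d by rewrite subr_ge0.
rewrite powRD_ge0//; under eq_bigr do rewrite powRD_ge0//.
apply: (@le_trans _ _ ((\sum_(0 <= k < n) `|x k| `^ r) * c `^ d)).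
  rewrite mulr_suml; apply: ler_sum => k _.
  by rewrite ler_wpM2l ?powR_ge0// ge0_ler_powR// nnegrE.
by rewrite ler_wpM2r ?powR_ge0.
Qed.

Lemma powR_add_le (r a b : R) : 0 < r -> 0 <= a -> 0 <= b ->
  (a + b) `^ r <= 2 `^ r * (a `^ r + b `^ r).
Proof.
move=> r0 a0 b0; wlog ab : a b a0 b0 / a <= b.
  move=> W; have [/W|/ltW ba] := leP a b; first exact.
  by rewrite addrC [X in _ * X]addrC; exact: W.
rewrite mulrDr -!powRM// ler_wpDl ?powR_ge0// powR_le ?addr_ge0 ?mulr_ge0//; lra.
Qed.

Lemma lp_le_add p : (0 < p)%E -> exists2 C, 0 < C & forall x y c d, 0 <= c -> 0 <= d ->
  lp_le p x c -> lp_le p y d -> lp_le p (x + y) (C * (c + d)).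
Proof.
case: p => [r||]// r0; last first.
  exists 1 => // x y c d c0 d0 xc yd k; rewrite mul1r.
  by apply: le_trans (ler_normD _ _) _; rewrite lerD.
rewrite lte_fin in r0; exists (2 * 2 `^ r^-1); first by rewrite mulr_gt0 ?powR_gt0.
move=> x y c d c0 d0 xc yd n.
rewrite -mulrA !powRM ?mulr_ge0 ?powR_ge0 ?addr_ge0//.
rewrite -powRrM mulVf ?lt0r_neq0// powRr1//.
apply: (@le_trans _ _ (\sum_(0 <= k < n) 2 `^ r * (`|x k| `^ r + `|y k| `^ r))).
  apply: ler_sum => k _; apply: le_trans (powR_add_le r0 _ _) => //.
  by rewrite powR_le ?addr_ge0// ler_normD.
rewrite -mulr_sumr ler_wpM2l ?powR_ge0// big_split/=.
apply: (le_trans (lerD (xc n) (yd n))).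
rewrite mulrDl mul1r lerD// powR_le ?addr_ge0//; lra.
Qed.

(** Taking the [k]-th entry from the [nu k]-th sequence costs at most the sum over [n]
    of the [r]-th powers of all the sequences; the weights [2 ^- n] make this sum
    converge, for [r < 1] as well. *)
Lemma lp_le_select p : (0 < p)%E -> exists2 C, 0 < C &
  forall (a : nat -> nat -> R) (nu : nat -> nat) c, 0 <= c ->
  (forall n, lp_le p (a n) c) ->
  lp_le p (fun k => 2 ^- nu k * a (nu k) k) (C * c).
Proof.
case: p => [r||]// r0; last first.
  exists 1 => // a nu c c0 H k; rewrite mul1r normrM -[c]mul1r ler_pM//.
  - by rewrite ger0_norm ?invr_ge0 ?exprn_ge0// invf_le1 ?exprn_gt0// exprn_ege1// ler1n.
  - exact: (H (nu k) k).
rewrite lte_fin in r0; pose z : R := 2 `^ (- r).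
have z0 : 0 <= z by exact: powR_ge0.
have z1 : z < 1.
  rewrite /z powRN invf_lt1 ?powR_gt0// ltNge.
  have := powR_le r0 (ler0n R 2) (@ler01 R); rewrite powR1 => ->.
  by rewrite -ltNge ltr1n.
have geo N : \sum_(0 <= n < N) z ^+ n <= (1 - z)^-1.
  have -> : \sum_(0 <= n < N) z ^+ n = (1 - z ^+ N) / (1 - z).
    apply: (canRL (mulfK _)); first by rewrite gt_eqF// subr_gt0.
    by rewrite big_mkord mulrC -opprB -[1 - z ^+ N]opprB subrX1 mulNr.
  by rewrite ler_pdivrMr ?subr_gt0// mulVf ?gt_eqF ?subr_gt0// gerBl exprn_ge0.
exists ((1 - z)^-1 `^ r^-1); first by rewrite powR_gt0// invr_gt0 subr_gt0.
move=> a nu c c0 H m.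
have iz0 : 0 <= (1 - z)^-1 by rewrite invr_ge0 subr_ge0 ltW.
rewrite powRM ?powR_ge0// -powRrM mulVf ?lt0r_neq0// powRr1//.
have [N nuN] : exists N, forall k, (k < m)%N -> (nu k < N)%N.
  exists (\max_(k < m) nu k).+1 => k km; rewrite ltnS.
  exact: (leq_bigmax (Ordinal km)).
apply: (@le_trans _ _ (\sum_(0 <= k < m) \sum_(0 <= n < N) z ^+ n * `|a n k| `^ r)).
  rewrite big_nat [leRHS]big_nat; apply: ler_sum => k /andP[_ km].
  rewrite [leRHS](bigD1_seq (nu k)) ?iota_uniq ?mem_index_iota ?nuN//=.
  rewrite normrM powRM// ger0_norm ?invr_ge0 ?exprn_ge0//.
  rewrite -[X in X <= _]addr0 lerD// ?sumr_ge0// => [|i _]; last first.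
    by rewrite mulr_ge0 ?exprn_ge0 ?powR_ge0.
  rewrite ler_wpM2r ?powR_ge0// -powR_mulrn// -powRrM mulNr.
  have -> : 2 ^- nu k = 2 `^ (- (nu k)%:R) :> R by rewrite powRN powR_mulrn.
  by rewrite -powRrM mulNr mulrC.
rewrite exchange_big/=.
apply: (@le_trans _ _ (\sum_(0 <= n < N) z ^+ n * c `^ r)).
  by apply: ler_sum => n _; rewrite -mulr_sumr ler_wpM2l ?exprn_ge0//; exact: H.
by rewrite -mulr_suml ler_wpM2r ?powR_ge0.
Qed.
End lp_norm.

(** * The K-functional of a couple of sequence lattices *)
Section couple.
Context (R : realType).
Implicit Types (x y : nat -> R) (N : (nat -> R) -> \bar R).

(** All that the proof that K-monotone lattices are K-spaces uses of the two spaces of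
    the couple. The selection property [lqn_select] lets one glue countably many
    sequences into a single one, coordinate by coordinate. *)
Record lattice_qnorm N : Prop := LatticeQnorm {
  lqn_ge0 : forall x, (0 <= N x)%E;
  lqn_scale : forall (a : R) x, (N (a *: x)%R <= `|a|%:E * N x)%E;
  lqn_mono : forall x y, (forall k, `|y k| <= `|x k|) -> (N y <= N x)%E;
  lqn_coord : forall x k, (`|x k|%:E <= N x)%E;
  lqn_delta : (N (fun k => (k == 0%N)%:R) < +oo)%E;
  lqn_select : exists2 C : R, 0 < C &
    forall (a : nat -> nat -> R) (nu : nat -> nat) (c : R), 0 <= c ->
    (forall n, (N (a n) <= c%:E)%E) ->
    (N (fun k => 2 ^- nu k * a (nu k) k)%R <= (C * c)%:E)%E }.

Lemma lp_lattice_qnorm (p : \bar R) : (0 < p)%E -> lattice_qnorm (lp_qnorm p).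
Proof.
move=> p0; split.
- by move=> x; exact: lp_qnorm_ge0.
- by move=> a x; exact: lp_scale.
- by move=> x y; exact: lp_mono.
- by move=> x k; exact: lp_coord.
- by apply: le_lt_trans (lp_delta p0) _; rewrite ltry.
- have [C C0 H] := lp_le_select p0; exists C => // a nu c c0 ac.
  apply/lp_leP => //; first by rewrite mulr_ge0// ltW.
  apply: H => // n.
  exact/lp_leP.
Qed.

Variables N0 N1 : (nat -> R) -> \bar R.
Hypotheses (N0P : lattice_qnorm N0) (N1P : lattice_qnorm N1).
Local Notation K := (Kfun N0 N1).
Local Notation sigma := (sigma_qnorm N0 N1).

Lemma sigmaE : sigma = K 1.
Proof.
apply/funext => x; congr ereal_inf; apply/seteqP; split=> r /= [a [b [? ? ? ->]]];
  by exists a, b; split=> //; rewrite mul1e.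
Qed.

Lemma Kfun_ge0 t x : 0 <= t -> (0 <= K t x)%E.
Proof.
move=> t0; apply/ereal_infP => _ [a [b [_ _ _ ->]]].
by rewrite adde_ge0 ?mule_ge0 ?lee_fin// ?lqn_ge0.
Qed.

Lemma Kfun_le t a b (c d : R) : 0 <= t -> (N0 a <= c%:E)%E -> (N1 b <= d%:E)%E ->
  (K t (a + b)%R <= (c + t * d)%:E)%E.
Proof.
move=> t0 ac bd; apply: ge_ereal_inf; exists (N0 a + t%:E * N1 b)%E.
  by exists a, b; split=> //; apply: le_lt_trans ac _ + apply: le_lt_trans bd _; exact: ltry.
by rewrite EFinD EFinM leeD// lee_wpmul2l// lee_fin.
Qed.

Lemma Kfun_lt t x (r : R) : (K t x < r%:E)%E -> exists a b (c d : R),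
  [/\ x = a + b, N0 a = c%:E, N1 b = d%:E, 0 <= c /\ 0 <= d & c + t * d < r].
Proof.
move=> /ereal_inf_lt[_ [a [b [afin bfin xab ->]]]].
have [c c0 ac] := ge0_is_fin_num (lqn_ge0 N0P a) afin.
have [d d0 bd] := ge0_is_fin_num (lqn_ge0 N1P b) bfin.
by rewrite ac bd -EFinM -EFinD lte_fin => r0; exists a, b, c, d.
Qed.

(** Inequalities between K-functionals reduce to real inequalities on decompositions. *)
Lemma Kfun_transfer s t x y (C : R) : 0 <= s -> 0 < C ->
  (forall a b (c d : R), x = a + b -> N0 a = c%:E -> N1 b = d%:E -> 0 <= c -> 0 <= d ->
     (K t y <= (C * (c + s * d))%:E)%E) ->
  (K t y <= C%:E * K s x)%E.
Proof.
move=> s0 C0 H; rewrite -lee_pdivrMl//; apply/ereal_infP => _ [a [b [afin bfin xab ->]]].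
have [c c0 ac] := ge0_is_fin_num (lqn_ge0 N0P a) afin.
have [d d0 bd] := ge0_is_fin_num (lqn_ge0 N1P b) bfin.
have -> : (N0 a + s%:E * N1 b)%E = (c + s * d)%:E by rewrite ac bd.
by rewrite lee_pdivrMl// -EFinM; exact: (H a b).
Qed.

Lemma Kfun_nondec s t x : 0 <= s -> s <= t -> (K s x <= K t x)%E.
Proof.
move=> s0 st; rewrite -[leRHS]mul1e; apply: Kfun_transfer => //; first exact: le_trans st.
move=> a b c d -> ac bd c0 d0; apply: (@le_trans _ _ (c + s * d)%:E).
  by apply: Kfun_le; rewrite ?ac ?bd.
by rewrite lee_fin mul1r lerD2l ler_wpM2r.
Qed.

(** Each decomposition contributes an affine function of [t] with nonnegative
    coefficients, whose quotient by [t] is nonincreasing. *)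
Lemma Kfun_quasi_concave s t x : 0 < s -> s <= t -> (K t x <= (t / s)%:E * K s x)%E.
Proof.
move=> s0 st; have t0 : 0 < t by exact: lt_le_trans st.
apply: Kfun_transfer => //; [exact: ltW|exact: divr_gt0|].
move=> a b c d -> ac bd c0 d0; apply: (@le_trans _ _ (c + t * d)%:E).
  by apply: Kfun_le; rewrite ?ac ?bd// ltW.
rewrite lee_fin mulrDr lerD//.
  by rewrite ler_peMl// ler_pdivlMr// mul1r.
by rewrite mulrA divfK ?gt_eqF.
Qed.

Lemma Kfun_le_sigma t x : 0 <= t -> (K t x <= (Num.max 1 t)%:E * sigma x)%E.
Proof.
move=> t0; rewrite sigmaE; have [t1|t1] := leP t 1.
  by rewrite mul1e; exact: Kfun_nondec.
by rewrite -[t in (t%:E * _)%E]divr1; apply: Kfun_quasi_concave; rewrite ?ltW.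
Qed.

(** As [y = m x] for a multiplier [m] bounded by [1], multiplying a decomposition of [x]
    by [m] gives one of [y] that is not larger. *)
Lemma Kfun_mono t x y : 0 <= t -> (forall k, `|y k| <= `|x k|) -> (K t y <= K t x)%E.
Proof.
move=> t0 yx; rewrite -[leRHS]mul1e; apply: Kfun_transfer => // a b c d xab ac bd c0 d0.
(* When [x k = 0] also [y k = 0], and the default value [m k = 0] is right. *)
pose m k := y k / x k.
have m1 k : `|m k| <= 1.
  rewrite /m; have [xk|xk] := eqVneq (x k) 0; first by rewrite xk invr0 mulr0 normr0.
  by rewrite normf_div ler_pdivrMr ?normr_gt0// mul1r.
have yE k : y k = m k * x k.
  rewrite /m; have [xk|xk] := eqVneq (x k) 0; last by rewrite divfK.
  by apply/eqP; have := yx k; rewrite xk mulr0 normr0 normr_le0.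
have mle (z : nat -> R) k : `|m k * z k| <= `|z k| by rewrite normrM ler_piMl.
have -> : y = (fun k => m k * a k) + (fun k => m k * b k).
  by apply/funext => k; rewrite yE xab [in LHS]/GRing.add/= mulrDr.
rewrite mul1r; apply: Kfun_le => //.
  by rewrite -ac; apply: lqn_mono.
by rewrite -bd; apply: lqn_mono.
Qed.

Lemma Kfun_scale t x (a : R) : 0 <= t -> 0 < a -> (K t (a *: x)%R <= a%:E * K t x)%E.
Proof.
move=> t0 a0; apply: Kfun_transfer => // u v c d -> uc vd c0 d0.
rewrite scalerDr mulrDr mulrCA; apply: Kfun_le => //.
  by rewrite EFinM -uc -[a in leRHS]gtr0_norm//; exact: lqn_scale.
by rewrite EFinM -vd -[a in leRHS]gtr0_norm//; exact: lqn_scale.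
Qed.

(** A selection is linear in the sequences, hence acts on their nearly optimal
    decompositions separately in each space of the couple. *)
Lemma Kfun_select : exists2 C : R, 0 < C &
  forall t (Y : nat -> nat -> R) (nu : nat -> nat) (r : R), 0 < t ->
  (forall n, (K t (Y n) < r%:E)%E) ->
  (K t (fun k => 2 ^- nu k * Y (nu k) k)%R <= (C * r)%:E)%E.
Proof.
have [C0 C00 H0] := lqn_select N0P; have [C1 C10 H1] := lqn_select N1P.
exists (C0 + C1); first exact: addr_gt0.
move=> t Y nu r t0 Yr.
have r0 : 0 < r by rewrite -lte_fin; apply: le_lt_trans (Yr 0%N); apply: Kfun_ge0; exact: ltW.
have /choice[A AP] n : exists ab : (nat -> R) * (nat -> R),
    [/\ Y n = ab.1 + ab.2, (N0 ab.1 <= r%:E)%E & (N1 ab.2 <= (r / t)%:E)%E].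
  have [a [b [c [d [Yab ac bd [c0 d0] cd]]]]] := Kfun_lt (Yr n).
  exists (a, b); split=> //=; rewrite ?ac ?bd lee_fin.
    by apply: ltW; apply: le_lt_trans cd; rewrite lerDl mulr_ge0// ltW.
  by rewrite ler_pdivlMr// mulrC; apply: ltW; apply: le_lt_trans cd; rewrite lerDr.
have -> : (fun k => 2 ^- nu k * Y (nu k) k) =
  (fun k => 2 ^- nu k * (A (nu k)).1 k) + (fun k => 2 ^- nu k * (A (nu k)).2 k).
  by apply/funext => k; rewrite [RHS]/GRing.add/= -mulrDr; have [-> _ _] := AP (nu k).
have -> : (C0 + C1) * r = C0 * r + t * (C1 * (r / t)).
  by field; rewrite gt_eqF.
apply: Kfun_le; first exact: ltW.
  by apply: (H0 (fun n => (A n).1)) => [|n]; [exact: ltW|have [] := AP n].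
by apply: (H1 (fun n => (A n).2)) => [|n]; [rewrite divr_ge0 ?ltW|have [] := AP n].
Qed.

Lemma sigma_coord x k : (`|x k|%:E <= sigma x)%E.
Proof.
apply/ereal_infP => _ [a [b [_ _ -> ->]]].
apply: (@le_trans _ _ (`|a k|%:E + `|b k|%:E)%E).
  by rewrite -EFinD lee_fin; exact: ler_normD.
by rewrite leeD//; exact: lqn_coord.
Qed.

Lemma Kfun_delta t : 0 <= t -> ((Num.min 1 t)%:E <= K t (fun k => (k == 0%N)%:R)%R)%E.
Proof.
move=> t0; apply/ereal_infP => _ [a [b [_ _ dab ->]]].
have ab : 1 <= `|a 0%N| + `|b 0%N|.
  have := congr1 (fun f => f 0%N) dab; rewrite /= [in RHS]/GRing.add/= => H.
  by rewrite -[leLHS]normr1 [X in `|X|]H ler_normD.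
apply: (@le_trans _ _ (`|a 0%N|%:E + t%:E * `|b 0%N|%:E)%E); last first.
  by rewrite leeD ?lee_wpmul2l ?lee_fin//; exact: lqn_coord.
rewrite -EFinM -EFinD lee_fin; have [t1|t1] := leP 1 t.
  by apply: le_trans ab _; rewrite lerD2l ler_peMl.
apply: (@le_trans _ _ (t * (`|a 0%N| + `|b 0%N|))); first by rewrite ler_peMr.
by rewrite mulrDr lerD2r ler_piMl// ltW.
Qed.

End couple.

(** * Classes of functions on the half-line *)
Section halfline.
Context (R : realType).
Local Notation mu := (halfline_measure R).
Local Notation L0 := (halfline_L0 R).
Implicit Types (f g : L0).

Lemma L0_funD f g : \forall t \ae mu, L0_fun (f + g) t = L0_fun f t + L0_fun g t.
Proof.
have := toL0K mu (L0_fun f + L0_fun g); apply: filterS => t /(_ I) ->.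
by rewrite mfunD.
Qed.

Lemma L0_funB f g : \forall t \ae mu, L0_fun (f - g) t = L0_fun f t - L0_fun g t.
Proof.
have H1 := L0_funD f (- g); have H2 := toL0K mu (- L0_fun g).
apply: filterS2 H1 H2 => t -> /(_ I).
rewrite mfunN /= => <-; by [].
Qed.

Lemma L0_funZ (a : R) f : \forall t \ae mu, L0_fun (a *: f) t = a * L0_fun f t.
Proof.
have := toL0K mu (a *: L0_fun f); apply: filterS => t /(_ I) ->; by [].
Qed.

Lemma L0_fun_eq0 f : (\forall t \ae mu, L0_fun f t = 0) -> f = 0.
Proof.
move=> f0; rewrite -(L0_funK f); apply/toL0P; apply: filterS f0 => t -> _; by [].
Qed.

Lemma L0_ex (g : R -> R) : measurable_fun (setT : set (measurableTypeR R)) g ->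
  exists f, \forall t \ae mu, L0_fun f t = g t.
Proof.
move=> mg.
pose G : {mfun (measurableTypeR R) >-> R} :=
  HB.pack (g : measurableTypeR R -> R) (isMeasurableFun.Build _ _ (measurableTypeR R) R g mg).
exists (toL0 mu G); apply: filterS (toL0K mu G) => t /(_ I) ->; by [].
Qed.

(** The half-line measure does not charge the nonpositive reals. *)
Lemma ae_gt0 : almost_everywhere mu (fun t : measurableTypeR R => (0 : R) < t).
Proof.
exists (~` `]0, +oo[%classic); split.
- by apply: measurableC; exact: measurable_itv.
- rewrite /halfline_measure /= /mrestr setICl measure0; by [].
- by move=> t /= h H; apply: h; move: H; rewrite in_itv/= andbT.
Qed.

Lemma ae_between (P : R -> Prop) (a b : R) : 0 < a -> a < b ->
  (\forall t \ae mu, P t) -> exists t, [/\ a < t, t < b & P t].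
Proof.
move=> a0 ab [N [mN N0 PN]]; apply: contrapT => H.
have abN : `]a, b[%classic `<=` N.
  move=> t /=; rewrite in_itv/= => /andP[a_t t_b]; apply: PN => /= Pt.
  by apply: H; exists t.
have : (mu `]a, b[%classic <= mu N)%E.
  by apply: le_measure; rewrite ?inE//; exact: measurable_itv.
have -> : mu `]a, b[%classic = (b - a)%:E.
  rewrite /halfline_measure /= /mrestr setIidl; last first.
    by move=> t /=; rewrite !in_itv/= andbT => /andP[/(lt_trans a0)].
  by rewrite lebesgue_measure_itv /= lte_fin ab.
by move: N0 => /= ->; rewrite lee_fin leNgt subr_gt0 ab.
Qed.

Lemma halfline_setT_gt0 : (0 < mu setT)%E.
Proof.
apply: (@lt_le_trans _ _ (mu `]1, 2[%classic)); last first.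
  by apply: le_measure; rewrite ?inE//; exact: measurable_itv.
rewrite /halfline_measure /= /mrestr setIidl; last first.
  by move=> t /=; rewrite !in_itv/= andbT => /andP[/(lt_trans ltr01)].
by rewrite lebesgue_measure_itv /= lte_fin ltr1n -EFinD lte_fin subr_gt0 ltr1n.
Qed.

Lemma Linfty_leP f (c : R) :
  (Linfty_qnorm f <= c%:E)%E <-> \forall t \ae mu, `|L0_fun f t| <= c.
Proof.
rewrite /Linfty_qnorm unlock halfline_setT_gt0; split => [/ess_supP|H].
  by apply: filterS => t /=; rewrite lee_fin.
by apply/ess_supP; apply: filterS H => t /=; rewrite lee_fin.
Qed.

Lemma Linfty_inv_leP f (c : R) :
  (Linfty_inv_qnorm f <= c%:E)%E <-> \forall t \ae mu, `|L0_fun f t| <= c * t.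
Proof.
have E (t : R) : 0 < t -> (`|L0_fun f t / t| <= c) = (`|L0_fun f t| <= c * t).
  by move=> t0; rewrite normf_div (gtr0_norm t0) ler_pdivrMr.
rewrite /Linfty_inv_qnorm unlock halfline_setT_gt0; split => [/ess_supP|] H.
  have H0 := ae_gt0; apply: filterS2 H0 H => t t0 /=; by rewrite lee_fin E.
by apply/ess_supP; apply: filterS2 ae_gt0 H => t t0 /=; rewrite lee_fin E.
Qed.
End halfline.

(** * Series in quasi-normed spaces *)
Section quasi_norm_series.
Context (R : realType) (V : lmodType R).
Implicit Types (N : V -> \bar R) (u : nat -> V).

Lemma ge0_cvge0P (a : nat -> \bar R) : (forall n, (0 <= a n)%E) ->
  (a n @[n --> \oo] --> 0%E) <->
  (forall e : R, 0 < e -> exists n0, forall n, (n0 <= n)%N -> (a n < e%:E)%E).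
Proof.
move=> a0; split=> [/fine_cvgP[fa /cvgrPdist_lt ca] e e0|H].
  have [n0 _ Hn] : \forall n \near \oo, a n \is a fin_num /\ `|0 - fine (a n)| < e.
    by near=> n; split; near: n => //; exact: ca.
  exists n0 => n nn0; have [fan] := Hn n nn0.
  by rewrite sub0r normrN ger0_norm ?fine_ge0// -lte_fin fineK.
apply/fine_cvgP; split.
  have [n0 Hn] := H 1 ltr01; exists n0 => // n /= /Hn an.
  by rewrite ge0_fin_numE// (lt_trans an)// ltry.
apply/cvgrPdist_lt => e e0; have [n0 Hn] := H e e0; exists n0 => // n /= /Hn an.
have fan : a n \is a fin_num by rewrite ge0_fin_numE// (lt_trans an)// ltry.
by rewrite sub0r normrN /= ger0_norm ?fine_ge0// -lte_fin fineK.
Unshelve. all: by end_near. Qed.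

Lemma qnorm0 N : quasi_norm N -> N 0 = 0%E.
Proof. by move=> [_ _ NZ _]; rewrite -(scale0r (0 : V)) NZ normr0 mul0e. Qed.

Lemma qnormN N x : quasi_norm N -> N (- x) = N x.
Proof. by move=> [_ _ NZ _]; rewrite -scaleN1r NZ normrN1 mul1e. Qed.

(** The sum is split off term by term, each step costing a factor [C]; the ratio
    [(2 C)^-1] is small enough for these factors to be absorbed. *)
Lemma qnorm_sum_geometric N (C : R) u : quasi_norm N -> 1 <= C ->
  (forall x y, (N (x + y)%R <= C%:E * (N x + N y))%E) ->
  (forall n, (N (u n) <= ((2 * C)^-1 ^+ n)%:E)%E) ->
  forall l m, (N (\sum_(m <= k < m + l) u k)%R <= (2 * C * (2 * C)^-1 ^+ m)%:E)%E.
Proof.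
move=> NP C1 NC uN; have C0 : 0 < C by exact: lt_le_trans C1.
elim=> [|l IH] m.
  rewrite addn0 big_geq// (qnorm0 NP) lee_fin.
  by rewrite mulr_ge0 ?exprn_ge0 ?invr_ge0// mulr_ge0// ltW.
rewrite big_ltn ?addnS ?ltnS ?leq_addr// -addSn.
apply: le_trans (NC _ _) _.
apply: (@le_trans _ _ (C%:E * (((2 * C)^-1 ^+ m)%:E + (2 * C * (2 * C)^-1 ^+ m.+1)%:E))%E).
  by apply: lee_wpmul2l; [rewrite lee_fin ltW|exact: leeD].
rewrite -EFinD -EFinM lee_fin exprS; set z := _ ^+ m.
suff -> : C * (z + 2 * C * ((2 * C)^-1 * z)) = 2 * C * z by [].
by field; rewrite gt_eqF.
Qed.

(** The substitute for absolutely convergent series: a quasi-norm need not be countably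
    subadditive, but terms that decay geometrically, fast enough with respect to the
    constant of the quasi-triangle inequality, have a convergent series. *)
Lemma quasi_banach_series N : quasi_banach N -> exists2 d : R, 0 < d <= 2^-1 &
  forall u, (forall n, (N (u n) <= (d ^+ n)%:E)%E) ->
  exists w, (N w < +oo)%E /\
    forall e : R, 0 < e -> exists n0, forall n, (n0 <= n)%N ->
      (N (\sum_(0 <= k < n) u k - w)%R < e%:E)%E.
Proof.
move=> [NP Ncomp]; have [N0 _ _ [C [C1 NC]]] := NP.
have C0 : 0 < C by exact: lt_le_trans C1.
exists (2 * C)^-1; first by rewrite invr_gt0 mulr_gt0//= lef_pV2 ?posrE ?mulr_gt0// ler_peMr.
move=> u uN; pose s n := \sum_(0 <= k < n) u k.
have tail m n : (m <= n)%N -> (N (s n - s m)%R <= (2 * C * (2 * C)^-1 ^+ m)%:E)%E.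
  move=> mn; rewrite /s (big_cat_nat (n:=m))//= addrAC subrr add0r -(subnKC mn).
  exact: qnorm_sum_geometric.
have small e : 0 < e -> exists m, 2 * C * (2 * C)^-1 ^+ m < e.
  move=> e0; have : (2 * C)^-1 ^+ n @[n --> \oo] --> (0 : R).
    apply: cvg_expr; rewrite ger0_norm ?invr_ge0 ?mulr_ge0 ?ltW//.
    by rewrite invf_lt1 ?mulr_gt0//; lra.
  move/cvgrPdist_lt => /(_ (e / (2 * C))); rewrite divr_gt0 ?mulr_gt0// => /(_ isT)[m _ Hm].
  exists m; have := Hm m (leqnn m); rewrite /= sub0r normrN ger0_norm; last first.
    by rewrite exprn_ge0// invr_ge0 mulr_ge0// ltW.
  by rewrite ltr_pdivlMr ?mulr_gt0// mulrC.
have [||w [wfin /ge0_cvge0P wlim]] := Ncomp s.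
- move=> n; have := tail 0%N n (leq0n n); rewrite {2}/s big_geq// subr0 => /le_lt_trans; apply.
  exact: ltry.
- move=> e e0; have [m me] := small e e0; exists m => i j mi mj.
  have mono i' : (m <= i')%N -> 2 * C * (2 * C)^-1 ^+ i' < e.
    move=> mi'; apply: le_lt_trans me; apply: ler_wpM2l; first by rewrite mulr_ge0// ltW.
    apply: ler_wiXn2l => //; first by rewrite invr_ge0 mulr_ge0// ltW.
    by rewrite invf_le1 ?mulr_gt0//; lra.
  have [ij|/ltnW ji] := leqP i j.
    rewrite -(qnormN _ NP) opprB; apply: le_lt_trans (tail _ _ ij) _.
    by rewrite lte_fin mono.
  by apply: le_lt_trans (tail _ _ ji) _; rewrite lte_fin mono.
exists w; split=> // e e0; apply: wlim => //; move=> n; exact: N0.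
Qed.

(** A Cauchy sequence has a subsequence whose successive differences decay at any
    prescribed speed, so it is enough to sum such series. *)
Lemma complete_of_series N (eps : nat -> R) : quasi_norm N -> (forall n, 0 < eps n) ->
  (forall u, (forall n, (N (u n) < (eps n)%:E)%E) ->
     exists w, (N w < +oo)%E /\
       forall e : R, 0 < e -> exists n0, forall n, (n0 <= n)%N ->
        (N (\sum_(0 <= k < n) u k - w)%R < e%:E)%E) ->
  complete_qnorm N.
Proof.
move=> NP eps0 H u ufin ucauchy; have [N0 _ _ [C [C1 NC]]] := NP.
have C0 : 0 < C by exact: lt_le_trans C1.
have /choice[g gP] k : exists n0, forall m n, (n0 <= m)%N -> (n0 <= n)%N ->
   (N (u m - u n)%R < (eps k)%:E)%E by exact: ucauchy.
pose n_ k := (\sum_(0 <= i < k.+1) (g i).+1)%N.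
have nS k : n_ k.+1 = (n_ k + (g k.+1).+1)%N by rewrite /n_ big_nat_recr.
have ng k : (g k <= n_ k)%N.
  by case: k => [|k]; [rewrite /n_ big_nat1|rewrite nS; lia].
have nk k : (k <= n_ k)%N by elim: k => // k IH; rewrite nS; lia.
pose d k := u (n_ k.+1) - u (n_ k).
have [|w [wfin wlim]] := H d.
  by move=> k; apply: gP; [rewrite nS; have := ng k; lia|exact: ng].
have sumd m : \sum_(0 <= k < m) d k = u (n_ m) - u (n_ 0%N) by rewrite telescope_sumr.
have fin_add x y : (N x < +oo)%E -> (N y < +oo)%E -> (N (x + y)%R < +oo)%E.
  move=> /(ge0_is_fin_num (N0 _))[a a0 xa] /(ge0_is_fin_num (N0 _))[b b0 yb].
  by apply: le_lt_trans (NC x y) _; rewrite xa yb -EFinD -EFinM ltry.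
exists (w + u (n_ 0%N)); split; first exact: fin_add.
apply/ge0_cvge0P => // e e0; pose e' := e / (2 * C).
have e'0 : 0 < e' by rewrite divr_gt0// mulr_gt0.
have [m1 Hm1] := wlim e' e'0; have [m2 Hm2] := ucauchy e' e'0.
pose m := maxn m1 m2; exists m2 => n m2n.
have -> : u n - (w + u (n_ 0%N)) = (u n - u (n_ m)) + (\sum_(0 <= k < m) d k - w).
  by rewrite sumd !addrA addrNK opprD addrA addrAC.
apply: le_lt_trans (NC _ _) _.
have A : (N (u n - u (n_ m))%R < e'%:E)%E.
  by apply: Hm2 => //; apply: leq_trans (nk m); exact: leq_maxr.
have B : (N (\sum_(0 <= k < m) d k - w)%R < e'%:E)%E by apply: Hm1; exact: leq_maxl.
have -> : e%:E = (C%:E * (e'%:E + e'%:E))%E.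
  by rewrite -EFinD -EFinM; congr EFin; rewrite /e'; field; rewrite gt_eqF.
by rewrite lte_pmul2l ?lte_fin// lteD.
Qed.
End quasi_norm_series.

(** * The parameter space E *)
Section E_space.
Context (R : realType).
Variables N0 N1 NX : (nat -> R) -> \bar R.
Hypotheses (N0P : lattice_qnorm N0) (N1P : lattice_qnorm N1).
Hypotheses (XP : sequence_lattice NX) (Xint : intermediate N0 N1 NX).
Local Notation K := (Kfun N0 N1).
Local Notation sigma := (sigma_qnorm N0 N1).
Local Notation mu := (halfline_measure R).
Local Notation L0 := (halfline_L0 R).
Implicit Types (x y : nat -> R) (f g : L0).

Definition absseq x : nat -> R := fun k => `|x k|.

(** [E] consists of the functions that are dominated by the K-functional of an element of
    [X], and its quasi-norm is the least size of such an element. *)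
Definition dominated f x := \forall t \ae mu, (`|L0_fun f t|%:E <= K t x)%E.

Definition E_qnorm f : \bar R :=
  ereal_inf [set NX x | x in [set x | (NX x < +oo)%E /\ dominated f x]].

Let NXq : quasi_norm NX := proj1 (proj1 XP).

Let NX_ge0 x : (0 <= NX x)%E.
Proof. by have [H _ _ _] := NXq. Qed.

Let NXZ (a : R) x : NX (a *: x) = (`|a|%:E * NX x)%E.
Proof. by have [_ _ H _] := NXq. Qed.

Let NX_mono x y : (forall k, `|y k| <= `|x k|) -> (NX y <= NX x)%E.
Proof. by have [_ H] := XP; exact: H. Qed.

Let NX_abs x : (NX (absseq x) <= NX x)%E.
Proof. by apply: NX_mono => k; rewrite normr_id. Qed.

Lemma ereal_le_mul_lt (a b : \bar R) (C : R) : 0 < C -> (0 <= a)%E ->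
  (forall r : R, (a < r%:E)%E -> (b <= (C * r)%:E)%E) -> (b <= C%:E * a)%E.
Proof.
move=> C0 a0 H; have [|] := ltP a +oo%E; last first.
  by rewrite leye_eq => /eqP ->; rewrite gt0_muley ?lte_fin// leey.
move=> /(ge0_is_fin_num a0)[c c0 ac]; apply/lee_addgt0Pr => e e0.
have := H (c + e / C); rewrite ac lte_fin ltrDl divr_gt0// => /(_ isT).
by rewrite -EFinM -EFinD mulrDr mulrCA divff ?gt_eqF// mulr1.
Qed.

Lemma KfunZ t x (a : R) : 0 <= t -> 0 < a -> K t (a *: x) = (a%:E * K t x)%E.
Proof.
move=> t0 a0; apply/eqP; rewrite eq_le Kfun_scale//= -lee_pdivlMl//.
have {1}-> : x = a^-1 *: (a *: x) by rewrite scalerA mulVf ?scale1r// gt_eqF.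
by apply: Kfun_scale => //; rewrite invr_gt0.
Qed.

Lemma E_qnorm_le f x : dominated f x -> (E_qnorm f <= NX x)%E.
Proof.
move=> fx; have [xfin|] := ltP (NX x) +oo%E; last first.
  by rewrite leye_eq => /eqP ->; rewrite leey.
by apply: ge_ereal_inf; exists (NX x) => //; exists x.
Qed.

Lemma E_qnorm_lt f (r : R) : (E_qnorm f < r%:E)%E -> exists2 x, dominated f x & (NX x < r%:E)%E.
Proof. by move=> /ereal_inf_lt[_ [x [_ fx] <-] xr]; exists x. Qed.

Lemma E_qnorm_ge0 f : (0 <= E_qnorm f)%E.
Proof. by apply/ereal_infP => _ [x _ <-]. Qed.

Lemma dominated_mono f g x y :
  (\forall t \ae mu, `|L0_fun g t| <= `|L0_fun f t|) -> (forall k, `|x k| <= `|y k|) ->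
  dominated f x -> dominated g y.
Proof.
move=> gf xy fx; have P := @ae_gt0 R.
rewrite /dominated in fx *; apply: filterS3 gf fx P => t gft fxt t0.
apply: le_trans (le_trans fxt _); first by rewrite lee_fin.
by apply: Kfun_mono => //; exact: ltW.
Qed.

(** In a couple of lattices [K t x + K t y <= 2 K t (|x| + |y|)], by monotonicity. This is
    why the sum of two K-functionals is again controlled by one. *)
Lemma dominatedD f g x y : dominated f x -> dominated g y ->
  dominated (f + g) (2 *: (absseq x + absseq y)).
Proof.
move=> fx gy; have P := @ae_gt0 R; have D := L0_funD f g.
rewrite /dominated in fx gy *.
have P' : almost_everywhere mu (fun t : measurableTypeR R => 0 < (t : R) /\
    L0_fun (f + g) t = L0_fun f t + L0_fun g t).
  by apply: filterS2 P D => t.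
apply: filterS3 fx gy P' => t fxt gyt [t0 ->].
have t0' := ltW t0; rewrite KfunZ//.
apply: (@le_trans _ _ (`|L0_fun f t|%:E + `|L0_fun g t|%:E)%E).
  by rewrite -EFinD lee_fin ler_normD.
have -> : (2%:E * K t (absseq x + absseq y)%R =
    K t (absseq x + absseq y)%R + K t (absseq x + absseq y)%R)%E.
  have -> : (2%:E = 1%:E + 1%:E :> \bar R)%E by rewrite -EFinD.
  by rewrite ge0_muleDl ?lee_fin// !mul1e.
have E2 k : `|(absseq x + absseq y) k| = `|x k| + `|y k|.
  by apply: ger0_norm; apply: addr_ge0; exact: normr_ge0.
apply: leeD; [apply: le_trans fxt _|apply: le_trans gyt _].
  by apply: Kfun_mono => // k; rewrite E2 lerDl.
by apply: Kfun_mono => // k; rewrite E2 lerDr.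
Qed.

Lemma dominatedZ (a : R) f x : a != 0 -> dominated f x -> dominated (a *: f) (`|a| *: x).
Proof.
move=> a0 fx; have P := @ae_gt0 R; have D := L0_funZ a f.
rewrite /dominated in fx *; apply: filterS3 fx D P => t fxt -> t0.
rewrite KfunZ ?normr_gt0//; last exact: ltW.
by rewrite normrM EFinM lee_wpmul2l ?lee_fin.
Qed.

Lemma dominated0 : dominated 0 0.
Proof.
have P := @ae_gt0 R; have D := L0_funZ 0 (0 : L0); rewrite scale0r in D.
apply: filterS2 D P => t -> t0; rewrite mul0r normr0.
by apply: Kfun_ge0 => //; exact: ltW.
Qed.

Lemma sigma_le : exists2 D : R, 0 < D & forall x, (sigma x <= D%:E * NX x)%E.
Proof. by have [_ [D [D0 H]]] := Xint; exists D. Qed.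

Lemma sigma_fin x : (NX x < +oo)%E -> (sigma x < +oo)%E.
Proof.
have [D D0 H] := sigma_le => /(ge0_is_fin_num (NX_ge0 _))[c c0 xc].
by apply: le_lt_trans (H x) _; rewrite xc -EFinM ltry.
Qed.

Lemma Kfun_fin t x : 0 <= t -> (NX x < +oo)%E -> exists2 c : R, 0 <= c & K t x = c%:E.
Proof.
move=> t0 /sigma_fin/(ge0_is_fin_num _)[|c c0 xc].
  by rewrite sigmaE; apply: Kfun_ge0.
apply: ge0_is_fin_num; first exact: Kfun_ge0.
apply: le_lt_trans (Kfun_le_sigma N0P N1P x t0) _.
by rewrite xc -EFinM ltry.
Qed.

(** If [f] is dominated by elements [x n] of [X] tending to zero, then almost everywhere
    [|f t| <= max 1 t * sigma (x n)] for all [n], and the right-hand side tends to zero. *)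
Lemma E_qnorm_eq0 f : E_qnorm f = 0%E -> f = 0.
Proof.
move=> f0; have [D D0 HD] := sigma_le.
have /choice[x xP] n : exists x, dominated f x /\ (NX x < n.+1%:R^-1%:E)%E.
  have [|x] := @E_qnorm_lt f n.+1%:R^-1; last by exists x.
  by rewrite f0 lte_fin invr_gt0.
have H : \forall t \ae mu, forall n, (`|L0_fun f t|%:E <= K t (x n))%E.
  by apply/ae_foralln => n; have [] := xP n.
apply: L0_fun_eq0; have P := @ae_gt0 R.
apply: filterS2 H P => t Ht t0.
apply/eqP; rewrite -normr_eq0 eq_le normr_ge0 andbT leNgt; apply/negP => ft0.
set M := Num.max 1 t; have M0 : 0 < M by rewrite lt_max ltr01.
have MD0 : 0 < M * D by rewrite mulr_gt0.
pose n := Num.truncn (M * D / `|L0_fun f t|).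
have : (`|L0_fun f t|%:E <= (M * (D * n.+1%:R^-1))%:E)%E.
  apply: le_trans (Ht n) _; apply: le_trans (Kfun_le_sigma N0P N1P _ (ltW t0)) _.
  rewrite EFinM lee_wpmul2l ?lee_fin ?(ltW M0)//; apply: le_trans (HD _) _.
  rewrite EFinM lee_wpmul2l ?lee_fin ?(ltW D0)//; apply: ltW; by have [] := xP n.
rewrite lee_fin mulrA ler_pdivlMr// leNgt [X in _ < X]mulrC -ltr_pdivrMr//.
by rewrite truncnS_gt.
Qed.

Lemma E_qnorm_quasi_norm : quasi_norm E_qnorm.
Proof.
have EZ (a : R) f : a != 0 -> (E_qnorm (a *: f)%R <= `|a|%:E * E_qnorm f)%E.
  move=> a0; have na0 : 0 < `|a| by rewrite normr_gt0.
  apply: ereal_le_mul_lt => //; first exact: E_qnorm_ge0.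
  move=> r /E_qnorm_lt[x fx xr]; apply: le_trans (E_qnorm_le (dominatedZ a0 fx)) _.
  by rewrite NXZ normr_id EFinM lee_wpmul2l ?lee_fin ?ltW.
split.
- exact: E_qnorm_ge0.
- exact: E_qnorm_eq0.
- move=> a f; have [->|a0] := eqVneq a 0.
    rewrite scale0r normr0 mul0e; apply/eqP; rewrite eq_le E_qnorm_ge0 andbT.
    by apply: le_trans (E_qnorm_le dominated0) _; rewrite (qnorm0 NXq).
  apply/eqP; rewrite eq_le EZ//= -lee_pdivlMl ?normr_gt0//.
  have {1}-> : f = a^-1 *: (a *: f) by rewrite scalerA mulVf ?scale1r.
  by apply: le_trans (EZ _ _ _) _; rewrite ?invr_eq0// normfV.
- have [_ _ _ [C [C1 NC]]] := NXq; have C0 : 0 < C by exact: lt_le_trans C1.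
  exists (2 * C); split; first by lra.
  move=> f g; apply: ereal_le_mul_lt; rewrite ?mulr_gt0 ?adde_ge0 ?E_qnorm_ge0//.
  move=> r fgr; have fin h h' : (E_qnorm h + E_qnorm h' < r%:E)%E -> (E_qnorm h < +oo)%E.
    move=> H; apply: (@le_lt_trans _ _ (E_qnorm h + E_qnorm h')%E).
      by rewrite leeDl// E_qnorm_ge0.
    by apply: lt_trans H _; rewrite ltry.
  have [a a0 fa] := ge0_is_fin_num (E_qnorm_ge0 f) (fin _ _ fgr).
  have [b b0 gb] : exists2 b : R, 0 <= b & E_qnorm g = b%:E.
    by apply: ge0_is_fin_num (E_qnorm_ge0 g) (fin g f _); rewrite addeC.
  move: fgr; rewrite fa gb -EFinD lte_fin => abr.
  pose e := (r - (a + b)) / 2; have e0 : 0 < e by rewrite divr_gt0// subr_gt0.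
  have [|x fx xa] := @E_qnorm_lt f (a + e); first by rewrite fa lte_fin ltrDl.
  have [|y gy yb] := @E_qnorm_lt g (b + e); first by rewrite gb lte_fin ltrDl.
  apply: le_trans (E_qnorm_le (dominatedD fx gy)) _.
  have -> : 2 * C * r = `|2| * (C * ((a + e) + (b + e))).
    by rewrite ger0_norm// /e; field.
  rewrite NXZ EFinM lee_wpmul2l ?lee_fin//; apply: le_trans (NC _ _) _.
  rewrite EFinM EFinD lee_wpmul2l ?lee_fin ?(ltW C0)//.
  by apply: leeD; apply: le_trans (NX_abs _) (ltW _).
Qed.

End E_space.

(** * Completeness of E *)
Lemma geometric_cauchy_cvg (R : realType) (a : nat -> R) (B : R) : 0 <= B ->
  (forall m n, (m <= n)%N -> `|a n - a m| <= B * 2^-1 ^+ m) -> cvg (a @ \oo).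
Proof.
move=> B0 H; apply/cauchy_cvgP/cauchy_exP => e e0.
have : B * 2^-1 ^+ n @[n --> \oo] --> B * (0 : R).
  by apply: cvgMr; apply: cvg_expr; rewrite ger0_norm//; lra.
rewrite mulr0 => /cvgrPdist_lt/(_ _ e0)[m _ Hm].
exists (a m); exists m => // n /= mn; rewrite /ball /=.
rewrite distrC; apply: le_lt_trans (H _ _ mn) _.
have := Hm m (leqnn m); rewrite /= sub0r normrN ger0_norm//.
by rewrite mulr_ge0// exprn_ge0.
Qed.

Lemma cvg_dist_le (R : realType) (a : nat -> R) (l b : R) m : a @ \oo --> l ->
  (forall n, (m <= n)%N -> `|a n - a m| <= b) -> `|a m - l| <= b.
Proof.
move=> /cvgrPdist_lt al H; apply/ler_addgt0Pr => e e0.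
have [n0 _ Hn] := al _ e0.
have := Hn (maxn m n0) (leq_maxr _ _); have := H (maxn m n0) (leq_maxl _ _) => /= A B.
rewrite distrC -(subrKA (a (maxn m n0)) l); apply: le_trans (ler_normD _ _) _.
by rewrite addrC lerD// ltW.
Qed.

Section E_complete.
Context (R : realType).
Variables N0 N1 NX : (nat -> R) -> \bar R.
Hypotheses (N0P : lattice_qnorm N0) (N1P : lattice_qnorm N1).
Hypotheses (XP : sequence_lattice NX) (Xint : intermediate N0 N1 NX).
Local Notation K := (Kfun N0 N1).
Local Notation sigma := (sigma_qnorm N0 N1).
Local Notation mu := (halfline_measure R).
Local Notation L0 := (halfline_L0 R).
Implicit Types (x y : nat -> R) (f g : L0).
Local Notation EN := (E_qnorm N0 N1 NX).

(** For a fast decreasing nonnegative sequence [u] in [X] the remainders [v m] of its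
    series tend to zero in [X] and dominate, coordinatewise, all terms from the [m]-th
    on: convergence in [X] implies that of the coordinates, since [X] embeds in the sum
    of the couple. *)
Lemma dominating_remainders : exists2 d : R, 0 < d <= 2^-1 &
  forall u : nat -> nat -> R, (forall n j, 0 <= u n j) ->
  (forall n, (NX (u n) <= (d ^+ n)%:E)%E) ->
  exists v : nat -> nat -> R, [/\ forall m, (NX (v m) < +oo)%E,
    forall e : R, 0 < e -> exists n0, forall n, (n0 <= n)%N -> (NX (v n) < e%:E)%E &
    forall m k j, (m <= k)%N -> u k j <= v m j].
Proof.
have NXq := proj1 (proj1 XP); have [Nge _ _ [C [C1 NC]]] := NXq.
have [D D0 HD] := sigma_le Xint.
have [d d12 H] := quasi_banach_series (proj1 XP).
exists d => // u u0 uN; have [w [wfin wlim]] := H u uN.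
have C0 : 0 < C by exact: lt_le_trans C1.
pose s n := \sum_(0 <= k < n) u k.
have sE n j : s n j = \sum_(0 <= k < n) u k j by rewrite /s fct_sumE.
exists (fun m => w - s m); split.
- move=> m; elim: m => [|m IH]; first by rewrite /s big_geq// subr0.
  have -> : w - s m.+1 = (w - s m) + (- u m).
    by rewrite /s big_nat_recr//= opprD addrA.
  have [b b0 mb] := ge0_is_fin_num (Nge _) IH.
  apply: le_lt_trans (NC _ _) _; rewrite mb (qnormN _ NXq).
  have [|c c0 ->] := @ge0_is_fin_num _ (NX (u m)) (Nge _).
    by apply: (@le_lt_trans _ _ (d ^+ m)%:E); last exact: ltry.
  by rewrite -EFinD -EFinM ltry.
- move=> e /wlim[n0 Hn0]; exists n0 => n /Hn0.
  by rewrite -(qnormN _ NXq) opprB.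
- move=> m k j mk; rewrite leNgt; apply/negP => vu.
  pose e := u k j - (w - s m) j; have e0 : 0 < e by rewrite subr_gt0.
  have [|n0 Hn0] := wlim (e / D); first exact: divr_gt0.
  pose n := maxn n0 k.+1; have := Hn0 n (leq_maxl _ _) => snw.
  have : (`|(s n - w) j|%:E < e%:E)%E.
    apply: le_lt_trans (sigma_coord N0P N1P _ _) _; apply: le_lt_trans (HD _) _.
    have -> : e%:E = (D%:E * (e / D)%:E)%E by rewrite -EFinM mulrC divfK// gt_eqF.
    by rewrite lte_pmul2l ?lte_fin.
  rewrite lte_fin => /ltr_normlP[_]; apply/negP; rewrite -leNgt /e.
  have -> : (s n - w) j = s n j - w j by [].
  have -> : (w - s m) j = w j - s m j by [].
  suff : u k j + s m j <= s n j by lra.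
  have kn : (k < n)%N by exact: leq_maxr.
  rewrite !sE (big_cat_nat (n:=m) (p:=n))//=; last by apply: leq_trans (ltnW kn).
  rewrite [leLHS]addrC lerD2l (big_cat_nat (n:=k) (p:=n))//=; last exact: ltnW.
  rewrite [X in _ <= _ + X]big_ltn// [leRHS]addrCA lerDl addr_ge0//; exact: sumr_ge0.
Qed.

(** Let [f k] be dominated by [x k], where [2 ^ k |x k|] is summable in [X] with remainders
    [v m]. Then [K t (x k) <= 2 ^- k K t (v m)] for [k >= m], so that the series of the
    [f k] converges almost everywhere, its remainder after [m] terms being at most
    [2 K t (v m)], where [v m] tends to zero in [X]. *)
Lemma E_qnorm_complete : complete_qnorm EN.
Proof.
have NXq := proj1 (proj1 XP); have [Nge _ NXZ _] := NXq.
have ENq := E_qnorm_quasi_norm N0P N1P XP Xint; have [ENge _ _ _] := ENq.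
have [d /andP[d0 d12] Hd] := dominating_remainders.
apply: (@complete_of_series _ _ _ (fun k => (d / 2) ^+ k)) => //.
  by move=> n; rewrite exprn_gt0// divr_gt0.
move=> f fP.
have /choice[x xP] n : exists x, dominated N0 N1 (f n) x /\ (NX x < ((d / 2) ^+ n)%:E)%E.
  by have [x] := E_qnorm_lt (fP n); exists x.
pose u n := 2 ^+ n *: absseq (x n).
have [||v [vfin vlim uv]] := Hd u.
- by move=> n j; apply: mulr_ge0; [exact: exprn_ge0|exact: normr_ge0].
- move=> n; rewrite /u NXZ ger0_norm ?exprn_ge0//.
  have -> : d ^+ n = 2 ^+ n * (d / 2) ^+ n by rewrite -exprMn mulrCA divff ?mulr1.
  rewrite EFinM lee_wpmul2l ?lee_fin ?exprn_ge0//; apply: ltW.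
  by apply: le_lt_trans (proj2 (xP n)); apply: (proj2 XP) => k; rewrite normr_id.
have v0 m j : 0 <= v m j.
  by apply: le_trans (uv m m j (leqnn m)); apply: mulr_ge0; [exact: exprn_ge0|exact: normr_ge0].
have Ku t k m : 0 < t -> (m <= k)%N -> (K t (x k) <= (2^-1 ^+ k)%:E * K t (v m))%E.
  move=> t0 mk; have t0' := ltW t0.
  rewrite -KfunZ ?exprn_gt0//; apply: Kfun_mono => // j.
  rewrite [leRHS]ger0_norm ?mulr_ge0 ?exprn_ge0//.
  have := uv m k j mk; rewrite /u => H.
  rewrite -[leLHS](mulKf (_ : 2 ^+ k != 0 :> R)) ?expf_neq0// -exprVn.
  by rewrite ler_wpM2l ?exprn_ge0.
pose s n := \sum_(0 <= k < n) f k.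
have sS n : \forall t \ae mu, L0_fun (s n.+1) t = L0_fun (s n) t + L0_fun (f n) t.
  by rewrite /s big_nat_recr//=; exact: L0_funD.
have Hae : \forall t \ae mu, [/\ (0 : R) < (t : measurableTypeR R),
    forall n, L0_fun (s n.+1) t = L0_fun (s n) t + L0_fun (f n) t &
    forall n, (`|L0_fun (f n) t|%:E <= K t (x n))%E].
  have P := @ae_gt0 R; have sS' := ae_foralln sS.
  have fx' : \forall t \ae mu, forall n, (`|L0_fun (f n) t|%:E <= K t (x n))%E.
    by apply: ae_foralln => n; have [] := xP n.
  by apply: filterS3 P sS' fx' => t; split.
have stail t k0 (c : R) : (0 : R) < t -> 0 <= c -> K t (v k0) = c%:E ->
  (forall n, L0_fun (s n.+1) t = L0_fun (s n) t + L0_fun (f n) t) ->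
  (forall n, (`|L0_fun (f n) t|%:E <= K t (x n))%E) ->
  forall m n, (k0 <= m)%N -> (m <= n)%N -> `|L0_fun (s n) t - L0_fun (s m) t| <= 2 * c * 2^-1 ^+ m.
  move=> t0 c0 vc Hs Hf m n k0m /subnKC <-.
  suff : `|L0_fun (s (m + (n - m))%N) t - L0_fun (s m) t| <=
      2 * c * (2^-1 ^+ m - 2^-1 ^+ (m + (n - m))).
    move/le_trans; apply; rewrite ler_wpM2l ?mulr_ge0// gerBl exprn_ge0//.
  elim: (n - m)%N => [|l IH]; first by rewrite addn0 !subrr normr0 mulr0.
  rewrite addnS Hs addrAC; apply: le_trans (ler_normD _ _) _.
  have fl : `|L0_fun (f (m + l)%N) t| <= 2^-1 ^+ (m + l) * c.
    rewrite -lee_fin; apply: le_trans (Hf _) _.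
    rewrite EFinM -vc; apply: Ku => //; lia.
  apply: le_trans (lerD IH fl) _; rewrite exprS.
  set z := 2^-1 ^+ (m + l); set y := 2^-1 ^+ m; lra.
(* The upper limit is measurable, and is the limit where that exists. *)
pose g t : R := fine (limn_esup (fun n => (L0_fun (s n) t)%:E)).
have [F FE] : exists F : L0, \forall t \ae mu, L0_fun F t = g t.
  apply: L0_ex; apply: measurableT_comp; first exact: fine_measurable.
  apply: measurable_fun_limn_esup => n; apply/measurable_EFinP.
  have ms : measurable_fun (setT : set (measurableTypeR R)) (L0_fun (s n)).
    exact: measurable_funPT.
  exact: ms.
have dom m : dominated N0 N1 (s m - F) (2 *: v m).
  have sF := L0_funB (s m) F; apply: filterS3 Hae FE sF => t [t0 Hs Hf] Ft ->.
  have [c c0 vc] := Kfun_fin N0P N1P XP Xint (ltW t0) (vfin 0%N).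
  have [cm cm0 vcm] := Kfun_fin N0P N1P XP Xint (ltW t0) (vfin m).
  have /cvg_ex[l sl] := @geometric_cauchy_cvg _ (fun n => L0_fun (s n) t) (2 * c)
    (mulr_ge0 (ler0n _ 2) c0) (fun i j ij => stail t 0%N c t0 c0 vc Hs Hf i j (leq0n i) ij).
  have gl : g t = l.
    have cl : (L0_fun (s n) t)%:E @[n --> \oo] --> l%:E by apply: cvg_EFin => //; exact: nearW.
    by rewrite /g (cvg_limn_einf_sup cl).2.
  rewrite Ft gl KfunZ ?(ltW t0)// vcm -EFinM lee_fin.
  apply: (@cvg_dist_le _ (fun n => L0_fun (s n) t)) => // n mn.
  apply: le_trans (stail t m cm t0 cm0 vcm Hs Hf m n (leqnn m) mn) _.
  by rewrite ler_piMr ?mulr_ge0// exprn_ile1//; lra.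
exists F; split.
  have := @E_qnorm_le _ _ _ NX _ _ (dom 0%N).
  rewrite /s big_geq// sub0r (qnormN _ ENq) => /le_lt_trans; apply.
  rewrite NXZ; have [c c0 ->] := ge0_is_fin_num (Nge _) (vfin 0%N).
  by rewrite -EFinM ltry.
move=> e e0; have [|n0 Hn0] := vlim (e / 2); first by rewrite divr_gt0.
exists n0 => n /Hn0 vn; apply: le_lt_trans (@E_qnorm_le _ _ _ NX _ _ (dom n)) _.
rewrite NXZ ger0_norm//; have -> : e%:E = (2%:E * (e / 2)%:E)%E.
  by rewrite -EFinM mulrCA divff ?mulr1.
by rewrite lte_pmul2l ?lte_fin.
Qed.
End E_complete.

(** * K-monotone lattices are K-spaces *)
(** Suprema over infinite sets need not be attained, but are up to a factor [2]. *)
Lemma exists_half_max (R : realType) (I : Type) (P : I -> Prop) (a : I -> R) (B : R) :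
  (exists i, P i) -> (forall i, P i -> 0 <= a i <= B) ->
  exists2 m, P m & forall i, P i -> a i <= 2 * a m.
Proof.
move=> [i0 Pi0] aB.
have [[i1 Pi1 ai1]|H] := pselect (exists2 i, P i & 0 < a i); last first.
  exists i0 => // i Pi; have /andP[ai _] := aB i Pi; have /andP[ai0 _] := aB i0 Pi0.
  apply: (@le_trans _ _ 0); last by rewrite mulr_ge0.
  by rewrite leNgt; apply/negP => ai'; apply: H; exists i.
pose S := [set a i | i in [set i | P i]].
have hS : has_sup S.
  split; first by exists (a i1), i1.
  by exists B => _ [i /= Pi <-]; have /andP[] := aB i Pi.
have s0 : 0 < sup S by apply: lt_le_trans ai1 _; apply: sup_ubound; [case: hS|exists i1].
have [_ [m /= Pm <-] ms] := sup_adherent (divr_gt0 s0 (ltr0n R 2)) hS.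
exists m => // i Pi; apply: (@le_trans _ _ (sup S)).
  by apply: sup_ubound; [case: hS|exists i].
rewrite mulrC -ler_pdivrMr// ltW//; apply: le_lt_trans ms; lra.
Qed.

Section K_space.
Context (R : realType).
Variables N0 N1 NX : (nat -> R) -> \bar R.
Hypotheses (N0P : lattice_qnorm N0) (N1P : lattice_qnorm N1).
Hypotheses (XP : sequence_lattice NX) (Xint : intermediate N0 N1 NX).
Local Notation K := (Kfun N0 N1).
Local Notation sigma := (sigma_qnorm N0 N1).
Local Notation mu := (halfline_measure R).
Local Notation L0 := (halfline_L0 R).
Implicit Types (x y : nat -> R) (f g : L0).
Local Notation EN := (E_qnorm N0 N1 NX).

(** K-monotonicity is only assumed qualitatively; the bound follows by a gliding hump.
    Otherwise there are [X n] of size [d ^ n] and [Y n] with smaller K-functionals but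
    huge quasi-norms. All [X n] are below one [v 0] in [X], so that the selection [y],
    whose [k]-th entry is nearly the largest of the [2 ^- n |Y n k|], has a K-functional
    bounded by that of a multiple of [v 0]. Hence [y] is in [X], although it dominates
    every [2 ^- n |Y n|] up to a factor [2]. *)
Lemma K_monotone_bound : K_monotone N0 N1 NX -> exists2 C : R, 0 < C &
  forall x y, (NX x < +oo)%E -> (sigma y < +oo)%E ->
  (forall t, 0 < t -> (K t y <= K t x)%E) -> (NX y <= C%:E * NX x)%E.
Proof.
move=> [_ Kmon]; have NXq := proj1 (proj1 XP); have [Nge Neq0 NXZ _] := NXq.
have [d /andP[d0 d12] Hd] := dominating_remainders N0P N1P XP Xint.
apply: contrapT => nC.
have bad n : exists xy : (nat -> R) * (nat -> R),
    [/\ (NX xy.1 <= (d ^+ n)%:E)%E, (sigma xy.2 < +oo)%E,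
      forall t, 0 < t -> (K t xy.2 <= K t xy.1)%E &
      ((n.+1%:R * 2 ^+ n)%:E < NX xy.2)%E].
  (* The factor [2 ^+ n] outweighs the weights of the selection, [d ^+ n] the scaling of
     [x] and [y] to the size [d ^+ n]. *)
  pose Cn : R := n.+1%:R * 2 ^+ n / d ^+ n.
  have Cn0 : 0 < Cn by rewrite divr_gt0 ?mulr_gt0 ?exprn_gt0.
  apply: contrapT => H; apply: nC; exists Cn => // x y xfin yfin yx.
  rewrite leNgt; apply/negP => xy; apply: H.
  have [c c0 xc] := ge0_is_fin_num (Nge x) xfin.
  have cpos : 0 < c.
    rewrite lt_neqAle c0 andbT; apply/eqP => c0'.
    have x0 : x = 0 by apply: Neq0; rewrite xc -c0'.
    have K0 : K 1 (0 : nat -> R) = 0%E.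
      apply/eqP; rewrite eq_le Kfun_ge0// andbT.
      have -> : (0 : nat -> R) = 0 + 0 by rewrite addr0.
      apply: le_trans (@Kfun_le _ N0 N1 1 0 0 0 0 ler01 _ _) _; rewrite ?mulr0 ?addr0//.
        by have := lqn_scale N0P 0 0; rewrite scale0r normr0 mul0e.
      by have := lqn_scale N1P 0 0; rewrite scale0r normr0 mul0e.
    have y0 : y = 0.
      apply/funext => k; apply/eqP; rewrite -normr_le0 -lee_fin.
      apply: le_trans (sigma_coord N0P N1P y k) _; rewrite sigmaE.
      by apply: le_trans (yx 1 ltr01) _; rewrite x0 K0.
    by move: xy; rewrite y0 x0 (qnorm0 NXq) mule0 ltxx.
  pose a := d ^+ n / c; have a0 : 0 < a by rewrite divr_gt0// exprn_gt0.
  exists (a *: x, a *: y); split=> /=.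
  - by rewrite NXZ gtr0_norm// xc -EFinM divfK ?gt_eqF.
  - rewrite sigmaE KfunZ//; move: yfin; rewrite sigmaE.
    move=> /(ge0_is_fin_num (Kfun_ge0 N0P N1P _ ler01))[b b0 ->].
    by rewrite -EFinM ltry.
  - move=> t t0; have t0' := ltW t0; rewrite !KfunZ// lee_wpmul2l ?lee_fin ?(ltW a0)//; exact: yx.
  - rewrite NXZ gtr0_norm// -lte_pdivrMl//; apply: le_lt_trans xy.
    rewrite xc -!EFinM lee_fin /Cn /a le_eqVlt; apply/orP; left; apply/eqP; field.
    by apply/andP; split; [exact: expf_neq0 (lt0r_neq0 d0)|exact: lt0r_neq0].
have /choice[xy xyP] := bad; pose X n := (xy n).1; pose Y n := (xy n).2.
have [||v [vfin _ Xv]] := Hd (fun n => absseq (X n)).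
- by move=> n j; exact: normr_ge0.
- move=> n; have [H _ _ _] := xyP n; apply: le_trans H.
  by apply: (proj2 XP) => k; rewrite normr_id.
have KY n t : 0 < t -> (K t (Y n) <= K t (v 0%N))%E.
  move=> t0; have [_ _ H _] := xyP n; apply: le_trans (H t t0) _.
  by apply: Kfun_mono => // [|k]; [exact: ltW|apply: le_trans (Xv 0%N n k _) (ler_norm _)].
have [B B0 vB] := Kfun_fin N0P N1P XP Xint ler01 (vfin 0%N).
have /choice[nu nuP] k : exists m, forall n, 2 ^- n * `|Y n k| <= 2 * (2 ^- m * `|Y m k|).
  have [||m _ Hm] := @exists_half_max R nat (fun=> True) (fun n => 2 ^- n * `|Y n k|) B.
  - by exists 0%N.
  - move=> n _; rewrite mulr_ge0 ?invr_ge0 ?exprn_ge0//=.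
    apply: (@le_trans _ _ `|Y n k|).
      by rewrite ler_piMl// invf_le1 ?exprn_gt0// exprn_ege1// ler1n.
    rewrite -lee_fin; apply: le_trans (sigma_coord N0P N1P _ _) _; rewrite sigmaE -vB.
    exact: KY.
  by exists m => n; exact: Hm.
have [C C0 HC] := Kfun_select N0P N1P.
pose y k := 2 ^- nu k * Y (nu k) k.
have Ky t : 0 < t -> (K t y <= K t (C *: v 0%N))%E.
  move=> t0; have t0' := ltW t0; rewrite KfunZ//.
  apply: ereal_le_mul_lt => //; first exact: Kfun_ge0.
  move=> r vr; apply: HC => // n; exact: le_lt_trans (KY n t t0) vr.
have Cvfin : (NX (C *: v 0%N)%R < +oo)%E.
  rewrite NXZ; have [c c0 ->] := ge0_is_fin_num (Nge _) (vfin 0%N).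
  by rewrite -EFinM ltry.
have yfin : (NX y < +oo)%E.
  apply: (Kmon (C *: v 0%N)) => //; rewrite sigmaE; apply: le_lt_trans (Ky 1 ltr01) _.
  by have [c c0 ->] := Kfun_fin N0P N1P XP Xint ler01 Cvfin; rewrite ltry.
have [M M0 yM] := ge0_is_fin_num (Nge y) yfin.
pose n := Num.truncn (2 * M).
have : (NX (2 ^- n *: Y n)%R <= NX (2 *: y)%R)%E.
  apply: (proj2 XP) => k; rewrite !normrM.
  have E2 m : `|2 ^- m| = 2 ^- m :> R by rewrite ger0_norm// invr_ge0 exprn_ge0.
  by rewrite !E2 (ger0_norm (ler0n R 2)); exact: nuP.
rewrite !NXZ yM -EFinM leNgt => /negP; apply.
rewrite !ger0_norm ?invr_ge0 ?exprn_ge0//.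
apply: (@lt_trans _ _ n.+1%:R%:E); first by rewrite lte_fin truncnS_gt.
have [_ _ _] := xyP n; rewrite -/(Y n) => H.
rewrite -lte_pdivrMl ?invr_gt0 ?exprn_gt0// invrK -EFinM mulrC.
exact: H.
Qed.


(** The K-functional is nondecreasing in [t], hence measurable. *)
Lemma Kfun_L0 x : (NX x < +oo)%E -> exists f, \forall t \ae mu, (L0_fun f t)%:E = K t x.
Proof.
move=> xfin; have Kx t : 0 <= t -> (fine (K t x))%:E = K t x.
  by move=> t0; have [c c0 ->] := Kfun_fin N0P N1P XP Xint t0 xfin.
pose g t := fine (K (Num.max 0 t) x).
have m0 (t : R) : 0 <= Num.max 0 t by rewrite le_max lexx.
have [f fg] : exists f : L0, \forall t \ae mu, L0_fun f t = g t.
  apply: L0_ex; apply: nondecreasing_measurable => // s t st.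
  rewrite -lee_fin !Kx//; apply: Kfun_nondec => //.
  by rewrite ge_max m0 le_max st orbT.
exists f; have P := @ae_gt0 R; apply: filterS2 P fg => t t0 ->.
by rewrite Kx//; congr Kfun; apply/max_idPr; exact: ltW.
Qed.

Lemma EK_qnorm_le x : (EK_qnorm N0 N1 EN x <= NX x)%E.
Proof.
have [xfin|] := ltP (NX x) +oo%E; last by rewrite leye_eq => /eqP ->; rewrite leey.
have [f fx] := Kfun_L0 xfin.
apply: ge_ereal_inf; exists (EN f); first by exists f.
apply: E_qnorm_le; have P := @ae_gt0 R; apply: filterS2 P fx => t t0 fxt.
have := Kfun_ge0 N0P N1P x (ltW t0); rewrite -fxt lee_fin => ft0.
by rewrite ger0_norm.
Qed.

(** An inequality that holds almost everywhere holds at some point of [(t, 2 t)], on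
    which the K-functional varies by a factor of at most [2]. *)
Lemma Kfun_ae_le x y : (\forall t \ae mu, (K t x <= K t y)%E) ->
  forall t, 0 < t -> (K t x <= K t (2 *: y))%E.
Proof.
move=> xy t t0.
have [|s [ts st Hs]] := @ae_between R (fun t => (K t x <= K t y)%E) t (2 * t) t0 _ xy.
  by rewrite ltr_pMl// ltr1n.
have t0' := ltW t0; rewrite KfunZ//.
apply: le_trans (Kfun_nondec N0P N1P x t0' (ltW ts)) _; apply: le_trans Hs _.
apply: le_trans (Kfun_quasi_concave N0P N1P y t0 (ltW ts)) _.
apply: lee_wpmul2r; first exact: Kfun_ge0.
by rewrite lee_fin ler_pdivrMr// ltW.
Qed.

Lemma EK_qnorm_equivalent : K_monotone N0 N1 NX -> equivalent_qnorm NX (EK_qnorm N0 N1 EN).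
Proof.
move=> /K_monotone_bound[C C0 HC]; have NXq := proj1 (proj1 XP); have [Nge _ NXZ _] := NXq.
split; first by exists 1; split=> // x; rewrite mul1e; exact: EK_qnorm_le.
exists (C * 2); split; first exact: mulr_gt0.
move=> x; rewrite -lee_pdivrMl ?mulr_gt0//; apply/ereal_infP => _ [f /= fx <-].
rewrite lee_pdivrMl ?mulr_gt0//; apply: ereal_le_mul_lt; rewrite ?mulr_gt0//.
  exact: E_qnorm_ge0.
move=> r /E_qnorm_lt[y fy yr].
have yfin : (NX y < +oo)%E by apply: lt_trans yr _; exact: ltry.
have y2fin : (NX (2 *: y)%R < +oo)%E.
  by rewrite NXZ; have [c c0 ->] := ge0_is_fin_num (Nge _) yfin; rewrite -EFinM ltry.
have Kxy : forall t, 0 < t -> (K t x <= K t (2 *: y))%E.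
  apply: Kfun_ae_le; apply: filterS2 fx fy => t <-; apply: le_trans.
  by rewrite lee_fin ler_norm.
have xfin : (sigma x < +oo)%E.
  rewrite sigmaE; apply: le_lt_trans (Kxy 1 ltr01) _.
  by have [c c0 ->] := Kfun_fin N0P N1P XP Xint ler01 y2fin; rewrite ltry.
apply: le_trans (HC _ _ y2fin xfin Kxy) _.
rewrite NXZ (ger0_norm (ler0n R 2)) muleA -EFinM [leRHS]EFinM.
by apply: lee_wpmul2l; [rewrite lee_fin mulr_ge0// ltW|exact: ltW].
Qed.

Lemma L0_split f (s : R) : exists f1 f2 : L0, [/\ f = f1 + f2,
  \forall t \ae mu, L0_fun f1 t = (if t <= s then L0_fun f t else 0) &
  \forall t \ae mu, L0_fun f2 t = (if t <= s then 0 else L0_fun f t)].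
Proof.
have mf : measurable_fun (setT : set (measurableTypeR R)) (L0_fun f) by exact: measurable_funPT.
have mA : measurable ([set` `]-oo, s]] : set (measurableTypeR R)) by exact: measurable_itv.
have [f1 Hf1] : exists f1 : L0,
    \forall t \ae mu, L0_fun f1 t = L0_fun f t * \1_([set` `]-oo, s]]) t.
  by apply: L0_ex; apply: measurable_funM => //; exact: measurable_indic.
have E (t : R) : \1_([set` `]-oo, s]]) t = (t <= s)%R%:R :> R.
  by rewrite indicE mem_setE in_itv.
exists f1, (f - f1); split; first by rewrite addrC subrK.
  by apply: filterS Hf1 => t ->; rewrite E; case: ifP => _; rewrite ?mulr1 ?mulr0.
have D := L0_funB f f1; apply: filterS2 Hf1 D => t Ht ->; rewrite Ht E.
by case: ifP => _; rewrite ?mulr1 ?subrr ?mulr0 ?subr0.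
Qed.

Local Notation sigmaL := (sigma_qnorm (@Linfty_qnorm R) (@Linfty_inv_qnorm R)).

Lemma Linfty_qnorm0 : (@Linfty_qnorm R 0 <= 0%:E)%E.
Proof.
apply/Linfty_leP; have Z := L0_funZ 0 (0 : L0); rewrite scale0r in Z.
by apply: filterS Z => t ->; rewrite mul0r normr0.
Qed.

Lemma Linfty_inv_qnorm0 : (@Linfty_inv_qnorm R 0 <= 0%:E)%E.
Proof.
apply/Linfty_inv_leP; have Z := L0_funZ 0 (0 : L0); rewrite scale0r in Z.
by apply: filterS Z => t ->; rewrite !mul0r normr0.
Qed.

Lemma sigmaL_le f1 f2 (c d : R) : (Linfty_qnorm f1 <= c%:E)%E -> (Linfty_inv_qnorm f2 <= d%:E)%E ->
  (sigmaL (f1 + f2)%R <= (c + d)%:E)%E.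
Proof.
move=> f1c f2d; apply: ge_ereal_inf; exists (Linfty_qnorm f1 + Linfty_inv_qnorm f2)%E.
  by exists f1, f2; split=> //; [apply: le_lt_trans f1c _|apply: le_lt_trans f2d _]; exact: ltry.
by rewrite EFinD leeD.
Qed.

(** Cutting [f] at [s]: by quasi-concavity [K t x] is at most [K s x] before [s], and at
    most [(t / s) K s x] after [s]. *)
Lemma Linfty_split f x (s c : R) : 0 < s -> dominated N0 N1 f x -> K s x = c%:E ->
  exists f1 f2, [/\ f = f1 + f2, (Linfty_qnorm f1 <= c%:E)%E &
    (Linfty_inv_qnorm f2 <= (c / s)%:E)%E].
Proof.
move=> s0 fx xc; have [f1 [f2 [fE Hf1 Hf2]]] := L0_split f s; exists f1, f2.
have c0 : 0 <= c by rewrite -lee_fin -xc Kfun_ge0// ltW.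
have P := @ae_gt0 R; split=> //.
  apply/Linfty_leP; rewrite /dominated in fx; apply: filterS3 P fx Hf1 => t t0 fxt ->.
  case: ifP => ts; last by rewrite normr0.
  rewrite -lee_fin -xc; apply: le_trans fxt _; apply: Kfun_nondec => //; exact: ltW.
apply/Linfty_inv_leP; rewrite /dominated in fx; apply: filterS3 P fx Hf2 => t t0 fxt ->.
case: ifP => ts; first by rewrite normr0 mulr_ge0 ?divr_ge0// ltW.
rewrite -lee_fin; apply: le_trans fxt _.
have st : s <= t by rewrite leNgt; apply/negP => /ltW; rewrite ts.
apply: le_trans (Kfun_quasi_concave N0P N1P x s0 st) _.
by rewrite xc -EFinM lee_fin (mulrAC t) (mulrC t) (mulrAC c).
Qed.

Lemma E_intermediate : intermediate (@Linfty_qnorm R) (@Linfty_inv_qnorm R) EN.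
Proof.
have NXq := proj1 (proj1 XP); have [Nge _ NXZ _] := NXq.
split.
  pose e0 : nat -> R := fun k => (k == 0%N)%:R.
  have [c c0 ec] : exists2 c : R, 0 <= c & NX e0 = c%:E.
    apply: ge0_is_fin_num => //; have [[D [D0 HD]] _] := Xint.
    apply: le_lt_trans (HD e0) _.
    have [a a0 Ha] := ge0_is_fin_num (lqn_ge0 N0P e0) (lqn_delta N0P).
    have [b b0 Hb] := ge0_is_fin_num (lqn_ge0 N1P e0) (lqn_delta N1P).
    by rewrite /delta_qnorm Ha Hb -EFin_max -EFinM ltry.
  exists (c + 1); split; first by rewrite ltr_wpDl.
  move=> f; apply: ereal_le_mul_lt; first by rewrite ltr_wpDl.
    by rewrite /delta_qnorm le_max; apply/orP; left; exact: Lnorm_ge0.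
  move=> r mr; have r0 : 0 < r.
    rewrite -lte_fin; apply: le_lt_trans mr; rewrite /delta_qnorm le_max.
    by apply/orP; left; exact: Lnorm_ge0.
  move: mr; rewrite /delta_qnorm gt_max => /andP[/ltW/Linfty_leP H0 /ltW/Linfty_inv_leP H1].
  suff : dominated N0 N1 f (r *: e0).
    move=> /(@E_qnorm_le _ _ _ NX) /le_trans; apply; rewrite NXZ gtr0_norm// ec -EFinM lee_fin.
    by rewrite mulrC ler_wpM2r ?(ltW r0)// lerDl.
  have P := @ae_gt0 R; apply: filterS3 P H0 H1 => t t0 H0t H1t; rewrite KfunZ ?(ltW t0)//.
  apply: (@le_trans _ _ (r%:E * (Num.min 1 t)%:E)%E); last first.
    by apply: lee_wpmul2l; [rewrite lee_fin ltW|apply: Kfun_delta => //; exact: ltW].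
  by rewrite -EFinM lee_fin /Num.min; case: ifP => _; rewrite ?mulr1.
have [D D0 HD] := sigma_le Xint.
exists (2 * D); split; first exact: mulr_gt0.
move=> f; apply: ereal_le_mul_lt; rewrite ?mulr_gt0 ?E_qnorm_ge0//.
move=> r /E_qnorm_lt[x fx xr].
have xfin : (NX x < +oo)%E by apply: lt_trans xr _; exact: ltry.
have [c c0 xc] := Kfun_fin N0P N1P XP Xint ler01 xfin.
have [f1 [f2 [-> Hf1 Hf2]]] := Linfty_split ltr01 fx xc.
apply: le_trans (sigmaL_le Hf1 Hf2) _; rewrite lee_fin divr1.
have : c <= D * r.
  rewrite -lee_fin -xc -sigmaE; apply: le_trans (HD x) _.
  by rewrite EFinM lee_wpmul2l ?lee_fin ?(ltW D0)// ltW.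
lra.
Qed.

Lemma ae_forall_rat (P : rat -> measurableTypeR R -> Prop) :
  (forall q, 0 < q -> \forall t \ae mu, P q t) ->
  \forall t \ae mu, forall q, 0 < q -> P q t.
Proof.
move=> H; have : \forall t \ae mu, forall n,
    if (unpickle n : option rat) is Some q then 0 < q -> P q t else True.
  apply: ae_foralln => n; case: unpickle => [q|]; last exact: nearW.
  have [q0|q0] := ltP 0 q; last by apply: nearW.
  by apply: filterS (H q q0) => t Pt _.
by apply: filterS => t Ht q; have := Ht (pickle q); rewrite pickleK.
Qed.

(** Let [T] be bounded on both spaces and [f] be dominated by [x]. Cutting [f] at [s]
    gives [|T f t| <= (C0 + C1 t / s) K s x] for almost every [t]; the exceptional sets
    for all rational [s] have a null union, and a rational [s] in [(t, 2 t)] yields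
    [|T f t| <= 2 (C0 + C1) K t x]. So [T f] is dominated by a multiple of [x]. *)
Lemma E_interpolation : interpolation_space (@Linfty_qnorm R) (@Linfty_inv_qnorm R) EN.
Proof.
have NXq := proj1 (proj1 XP); have [Nge _ NXZ _] := NXq.
split; [split; [exact: E_qnorm_quasi_norm|exact: E_qnorm_complete]|exact: E_intermediate|].
move=> T [_ Tlin] [C0 [C00 HC0]] [C1 [C10 HC1]].
pose C := 2 * (C0 + C1); have Cpos : 0 < C by rewrite mulr_gt0// addr_gt0.
exists C; split=> // f _; apply: ereal_le_mul_lt; rewrite ?E_qnorm_ge0//.
move=> r /E_qnorm_lt[x fx xr].
have xfin : (NX x < +oo)%E by apply: lt_trans xr _; exact: ltry.
suff : dominated N0 N1 (T f) (C *: x).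
  move=> /(@E_qnorm_le _ _ _ NX) /le_trans; apply; rewrite NXZ gtr0_norm// [leRHS]EFinM.
  by apply: lee_wpmul2l; [rewrite lee_fin ltW|exact: ltW].
have H : \forall t \ae mu, forall q : rat, 0 < q ->
    (0 : R) < (t : measurableTypeR R) ->
    (`|L0_fun (T f) t|%:E <= (C0 + C1 * (t / ratr q))%:E * K (ratr q) x)%E.
  apply: ae_forall_rat => q q0; have s0 : (0 : R) < ratr q by rewrite ltr0q.
  have [c c0 xc] := Kfun_fin N0P N1P XP Xint (ltW s0) xfin.
  have [f1 [f2 [fE Hf1 Hf2]]] := Linfty_split s0 fx xc.
  have f1fin : (Linfty_qnorm f1 < +oo)%E by apply: le_lt_trans Hf1 _; exact: ltry.
  have f2fin : (Linfty_inv_qnorm f2 < +oo)%E by apply: le_lt_trans Hf2 _; exact: ltry.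
  have f1s : (sigmaL f1 < +oo)%E.
    rewrite -[f1]addr0; apply: le_lt_trans (sigmaL_le Hf1 Linfty_inv_qnorm0) _; exact: ltry.
  have f2s : (sigmaL f2 < +oo)%E.
    rewrite -[f2]add0r; apply: le_lt_trans (sigmaL_le Linfty_qnorm0 Hf2) _; exact: ltry.
  have TfE : T f = T f1 + T f2 by have := Tlin 1 f1 f2 f1s f2s; rewrite !scale1r -fE.
  have T1 : (Linfty_qnorm (T f1) <= (C0 * c)%:E)%E.
    by apply: le_trans (HC0 _ f1fin) _; rewrite EFinM lee_wpmul2l ?lee_fin ?(ltW C00).
  have T2 : (Linfty_inv_qnorm (T f2) <= (C1 * (c / ratr q))%:E)%E.
    by apply: le_trans (HC1 _ f2fin) _; rewrite EFinM lee_wpmul2l ?lee_fin ?(ltW C10).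
  move/Linfty_leP: T1 => T1; move/Linfty_inv_leP: T2 => T2.
  have D := L0_funD (T f1) (T f2); rewrite TfE.
  apply: filterS3 D T1 T2 => t -> Ht1 Ht2 t0; rewrite xc -EFinM lee_fin.
  apply: le_trans (ler_normD _ _) _; apply: le_trans (lerD Ht1 Ht2) _.
  have E (a b u v : R) : a * (b / u) * v = a * (v / u) * b by ring.
  by rewrite mulrDl lerD2l E.
have P := @ae_gt0 R; apply: filterS2 P H => t t0 Ht.
have [q] : exists q : rat, ratr q \in `]t, 2 * t[%R by apply: rat_in_itvoo; rewrite ltr_pMl// ltr1n.
rewrite in_itv/= => /andP[tq qt].
have q0 : 0 < q by rewrite -(ltr0q R); exact: lt_trans t0 tq.
apply: le_trans (Ht q q0 t0) _; rewrite KfunZ ?(ltW t0)//.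
have KK : (K (ratr q) x <= 2%:E * K t x)%E.
  apply: le_trans (Kfun_quasi_concave N0P N1P x t0 (ltW tq)) _.
  apply: lee_wpmul2r; first by rewrite Kfun_ge0// ltW.
  by rewrite lee_fin ler_pdivrMr// ltW.
apply: (@le_trans _ _ ((C0 + C1)%:E * K (ratr q) x)%E).
  apply: lee_wpmul2r; first by rewrite Kfun_ge0// ler0q ltW.
  rewrite lee_fin lerD2l ler_piMr ?(ltW C10)// ler_pdivrMr ?mul1r ?(ltW tq)//.
  exact: lt_trans t0 tq.
apply: le_trans (lee_wpmul2l _ KK) _; first by rewrite lee_fin addr_ge0// ltW.
by rewrite muleA -EFinM /C mulrC.
Qed.

Theorem K_space_of_K_monotone : K_monotone N0 N1 NX -> K_space N0 N1 NX.
Proof.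
move=> Kmon; exists EN; split.
- split; first by split; [exact: E_qnorm_quasi_norm|exact: E_qnorm_complete].
  move=> f g gf; apply/ereal_infP => _ [x [xfin fx] <-].
  by apply: E_qnorm_le; apply: dominated_mono fx.
- exact: E_interpolation.
- exact: EK_qnorm_equivalent.
Qed.
End K_space.

(** * Head and tail majorization of sequences *)
Section majorization.
Context (R : realType).
Implicit Types (a b A B : nat -> R).

Lemma sum_uniq_le (P : pred nat) (a : nat -> R) (c : R) n : 0 <= c ->
  (forall k k', P k -> P k' -> k = k') -> (forall k, P k -> a k <= c) ->
  \sum_(0 <= k < n | P k) a k <= c.
Proof.
move=> c0 P1 ac; elim: n => [|n IH]; first by rewrite big_geq.
rewrite big_mkcond big_nat_recr//= -big_mkcond; case: ifP => Pn; last by rewrite addr0.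
rewrite big_nat_cond big_pred0 ?add0r ?ac// => k.
by apply/negbTE/negP => /andP[/andP[_ kn] /P1/(_ Pn) kE]; move: kn; rewrite kE ltnn.
Qed.

Lemma sum_mono a n m : (forall k, 0 <= a k) -> (n <= m)%N ->
  \sum_(0 <= k < n) a k <= \sum_(0 <= k < m) a k.
Proof.
move=> a0 nm; rewrite (big_cat_nat (n:=n) (p:=m))//= lerDl.
by apply: sumr_ge0.
Qed.

(** Bin packing: the item [k], of size [a k], is put into the bin [phi k], of size
    [4 b (phi k)]. Lay the items end to end, and next to them the bins [2 b j] end to
    end; an item goes to the bin that contains its left end point. Only the last item of
    a bin can stick out, and the bound on [k.+1%:R * a k] keeps its size below [2 b j]. *)
Lemma head_assignment a b : (forall k, 0 <= a k) -> (forall k, 0 <= b k) ->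
  (forall m n, (m <= n)%N -> b n <= b m) ->
  (forall n, \sum_(0 <= k < n) a k <= \sum_(0 <= k < n) b k) ->
  (forall k, k.+1%:R * a k <= \sum_(0 <= i < k.+1) b i) ->
  exists phi : nat -> nat, forall j n, \sum_(0 <= k < n | phi k == j) a k <= 4 * b j.
Proof.
move=> a0 b0 bmono ab kab.
pose A n := \sum_(0 <= k < n) a k; pose B n := \sum_(0 <= k < n) b k.
have AS n : A n.+1 = A n + a n by rewrite /A big_nat_recr.
have BS n : B n.+1 = B n + b n by rewrite /B big_nat_recr.
have B_ge0 n : 0 <= B n by exact: sumr_ge0.
have A_ge0 n : 0 <= A n by exact: sumr_ge0.
have BD j l : B (j + l)%N <= B j + l%:R * b j.
  elim: l => [|l IH]; first by rewrite addn0 mul0r addr0.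
  rewrite addnS BS -natr1 mulrDl mul1r addrA lerD//.
  by apply: bmono; exact: leq_addr.
(* The alternative [j == k] only makes the search total: if [a k > 0] it also satisfies
   the inequality. *)
have exj k : exists j, (A k < 2 * B j.+1) || (j == k) by exists k; rewrite eqxx orbT.
pose phi k := ex_minn (exj k).
have phiP k : 0 < a k -> [/\ 2 * B (phi k) <= A k, A k < 2 * B (phi k).+1 & a k <= 2 * b (phi k)].
  move=> ak; rewrite /phi; case: ex_minnP => j jP jmin.
  have Bk : 0 < B k.+1 by apply: lt_le_trans (kab k); rewrite mulr_gt0.
  have AB : A k <= B k.+1 by apply: le_trans (ab k) _; rewrite BS lerDl.
  have jk : (j <= k)%N by apply: jmin; rewrite eqxx orbT.
  have Aj : A k < 2 * B j.+1.
    by case/orP: jP => // /eqP ->; rewrite mulr_natl mulr2n ltr_pwDl.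
  have Bj : 2 * B j <= A k.
    case: j jP jmin jk Aj => [|j] _ jmin jk _; first by rewrite /B big_geq// mulr0.
    rewrite leNgt; apply/negP => Aj.
    by have := jmin j; rewrite Aj /= => /(_ isT); rewrite ltnn.
  split=> //; have := BD j (k.+1 - j)%N; rewrite subnKC ?leqW// => H.
  have H2 : (k.+1 - j)%:R * b j <= k.+1%:R * b j by rewrite ler_wpM2r// ler_nat leq_subr.
  have := kab k; rewrite -/(B k.+1) => H3.
  have : k.+1%:R * a k <= k.+1%:R * (2 * b j) by lra.
  by rewrite ler_pM2l.
exists phi => j; pose s n := \sum_(0 <= k < n | phi k == j) a k.
have sS n : s n.+1 = s n + (if phi n == j then a n else 0).
  by rewrite /s big_mkcond big_nat_recr//= -big_mkcond.
have sA n : s n <= Num.max 0 (A n - 2 * B j).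
  elim: n => [|n IH]; first by rewrite /s big_geq// le_max lexx.
  rewrite sS AS; have [an|an] := eqVneq (a n) 0.
    by rewrite an if_same !addr0.
  have {}an : 0 < a n by rewrite lt_neqAle eq_sym an a0.
  case: eqVneq => [pj|_].
    have [H _ _] := phiP n an; rewrite pj in H.
    have : s n <= A n - 2 * B j by move: IH; rewrite (max_idPr _)// subr_ge0.
    by move=> H'; rewrite le_max; apply/orP; right; lra.
  rewrite addr0; apply: le_trans IH _; rewrite ge_max !le_max lexx/=.
  by apply/orP; right; lra.
elim=> [|n IH]; first by rewrite big_geq// mulr_ge0.
rewrite -/(s n.+1) sS; case: eqVneq => [pj|_]; last by rewrite addr0.
have [an|an] := eqVneq (a n) 0; first by rewrite an addr0.
have {}an : 0 < a n by rewrite lt_neqAle eq_sym an a0.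
have [H1 H2 H3] := phiP n an; rewrite pj in H1 H2 H3.
have : s n <= A n - 2 * B j by have := sA n; rewrite (max_idPr _)// subr_ge0.
by rewrite BS in H2; lra.
Qed.

Lemma tail_sums a (M : R) : (forall k, 0 <= a k) ->
  (forall n, \sum_(0 <= k < n) a k <= M) ->
  exists A, [/\ forall n, A n = a n + A n.+1, forall n, 0 <= A n,
    forall e, 0 < e -> exists n, A n < e &
    forall n (c : R), (forall m, \sum_(n <= k < m) a k <= c) -> A n <= c].
Proof.
move=> a0 aM; pose s n := \sum_(0 <= k < n) a k.
pose E := [set s n | n in [set: nat]]; have hE : has_sup E.
  by split; [exists (s 0%N), 0%N|exists M => _ [n _ <-]; exact: aM].
have sE n : s n <= sup E by apply: sup_ubound; [case: hE|exists n].
(* The tails of the series with sum [sup E]. *)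
exists (fun n => sup E - s n); split.
- by move=> n; rewrite /s big_nat_recr//=; lra.
- by move=> n; rewrite subr_ge0.
- move=> e e0; have [_ [n _ <-] H] := sup_adherent e0 hE.
  by exists n; lra.
- move=> n c ac; suff : sup E <= c + s n by lra.
  apply: ge_sup; first by case: hE.
  move=> _ [m _ <-]; have [nm|/ltnW mn] := leqP n m.
    by rewrite /s (big_cat_nat (n:=n) (p:=m))//= addrC lerD2r.
  apply: le_trans (sum_mono a0 mn) _; rewrite lerDr.
  by have := ac n; rewrite big_geq.
Qed.

Lemma tail_sum_le a A n m : (forall n, A n = a n + A n.+1) -> (forall n, 0 <= A n) ->
  \sum_(n <= k < m) a k <= A n.
Proof.
move=> AS A0; have [nm|/ltnW mn] := leqP n m; last by rewrite big_geq.
rewrite (eq_bigr (fun k => (- A k.+1) - (- A k))); last first.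
  by move=> k _; rewrite (AS k); lra.
by rewrite telescope_sumr//; have := A0 m; lra.
Qed.

(** Lay out the tails [A k] and [B j] from infinity: the block of [k] collects the [j]
    for which [B j] falls in the upper half of the interval between [A k.+1] and [A k]. *)
Definition tail_block a A B (k : nat) : pred nat :=
  [pred j | (A k - a k / 2 < B j) && (B j <= A k)].

Lemma tail_block_disjoint a A B j k k' : (forall k, 0 <= a k) ->
  (forall n, A n = a n + A n.+1) -> tail_block a A B k j -> tail_block a A B k' j -> k = k'.
Proof.
move=> a0 AS; have Amono m n : (m <= n)%N -> A n <= A m.
  move=> /subnKC <-; elim: (n - m)%N => [|l IH]; first by rewrite addn0.
  by rewrite addnS; apply: le_trans IH; rewrite (AS (m + l)%N) lerDr.
wlog kk' : k k' / (k <= k')%N.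
  by move=> W Hk Hk'; have [/W|/ltnW/W] := leqP k k'; [apply|move=> H; apply/esym; exact: H].
move=> /= /andP[H1 _] /andP[_ H2]; move: kk'; rewrite leq_eqVlt => /predU1P[//|kk'].
exfalso; have := Amono _ _ kk'; have := AS k; have := a0 k; lra.
Qed.

(** As [A k <= B k], the terms of [b] that meet the interval of [k] come at or after the
    [k]-th one, so that they are at most [b k], a small fraction of [a k]. Hence they
    fill half of that interval up to an error of [b k]. *)
Lemma tail_block_sum a b A B k : (forall k, 0 <= a k) -> (forall k, 0 <= b k) ->
  (forall m n, (m <= n)%N -> b n <= b m) ->
  (forall n, A n = a n + A n.+1) -> (forall n, 0 <= A n) ->
  (forall n, B n = b n + B n.+1) -> (forall e, 0 < e -> exists n, B n < e) ->
  (forall n, A n <= B n) -> 4 * b k < a k ->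
  exists m, (forall j, tail_block a A B k j -> (j < m)%N) /\
    a k / 4 <= \sum_(0 <= j < m | tail_block a A B k j) b j.
Proof.
move=> a0 b0 bmono AS A0 BS Blim AB ab.
have Bmono m n : (m <= n)%N -> B n <= B m.
  move=> /subnKC <-; elim: (n - m)%N => [|l IH]; first by rewrite addn0.
  by rewrite addnS; apply: le_trans IH; rewrite (BS (m + l)%N) lerDr.
have ak : 0 < a k by apply: le_lt_trans ab; rewrite mulr_ge0.
have Ak : a k <= A k by rewrite (AS k) lerDl.
have exl : exists j, B j <= A k.
  by have [n /ltW ?] := Blim (A k) (lt_le_trans ak Ak); exists n.
have exm : exists j, B j <= A k - a k / 2.
  have [|n /ltW ?] := Blim (A k - a k / 2); first lra.
  by exists n.
case: (ex_minnP exl) => l lP lmin; case: (ex_minnP exm) => m mP mmin.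
have lm : (l <= m)%N by apply: lmin; lra.
exists m; split.
  move=> j /= /andP[H _]; rewrite ltnNge; apply/negP => mj.
  by have := Bmono _ _ mj; lra.
apply: (@le_trans _ _ (\sum_(l <= j < m) b j)); last first.
  rewrite [leRHS](big_cat_nat (n:=l) (p:=m))//=.
  have -> : \sum_(l <= j < m) b j = \sum_(l <= j < m | tail_block a A B k j) b j.
    rewrite [LHS]big_nat_cond [RHS]big_nat_cond; apply: eq_bigl => j /=; rewrite andbT.
    apply/idP/idP => [/andP[lj jm]|/andP[]//].
    rewrite lj jm /=; apply/andP; split; last by apply: le_trans lP; exact: Bmono.
    by rewrite ltNge; apply/negP => /mmin; rewrite leqNgt jm.
  by rewrite lerDr sumr_ge0.
have -> : \sum_(l <= j < m) b j = B l - B m.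
  rewrite (eq_bigr (fun k => (- B k.+1) - (- B k))); last first.
    by move=> j _; rewrite (BS j); lra.
  by rewrite telescope_sumr//; lra.
suff : A k - a k / 4 <= B l by lra.
have [lk|kl] := leqP l k; first by have := Bmono _ _ lk; have := AB k; lra.
case: l kl lP lmin lm => // l kl _ lmin _.
have : A k < B l by rewrite ltNge; apply/negP => /lmin; rewrite ltnn.
by have := bmono k l kl; have := BS l; lra.
Qed.
End majorization.

(** * Operators bounded on the spaces of the couple *)
Section operators.
Context (R : realType).
Implicit Types (x y z : nat -> R) (T : (nat -> R) -> nat -> R) (p q : \bar R).

Definition lin T := forall (a : R) x y, T (a *: x + y) = a *: T x + T y.

Definition lp_bounded p T := exists2 D : R, 0 < D &
  forall z, (lp_qnorm p (T z) <= D%:E * lp_qnorm p z)%E.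

(** All operators of the proof but one are of this form. They are bounded on [l^q] for
    all [q >= p] once the [p]-th powers of the weights in each fiber of [phi] have
    bounded sums. *)
Definition weighted_reindex (phi : nat -> nat) (r : nat -> R) z : nat -> R :=
  fun k => r k * z (phi k).

Lemma weighted_reindex_lin phi r : lin (weighted_reindex phi r).
Proof.
move=> a x y; apply/funext => k; rewrite /weighted_reindex.
have -> : (a *: x + y) (phi k) = a * x (phi k) + y (phi k) by [].
have -> : (a *: (fun k => r k * x (phi k)) + (fun k => r k * y (phi k))) k =
  a * (r k * x (phi k)) + r k * y (phi k) by [].
by rewrite mulrDr mulrCA.
Qed.

Lemma sum_reindex_le (phi : nat -> nat) (w u : nat -> R) (C c : R) n : 0 <= C ->
  (forall k, 0 <= u k) ->
  (forall j m, \sum_(0 <= k < m | phi k == j) w k <= C) ->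
  (forall m, \sum_(0 <= k < m) u k <= c) ->
  \sum_(0 <= k < n) w k * u (phi k) <= C * c.
Proof.
move=> C0 u0 wC uc.
have [N phiN] : exists N, forall k, (k < n)%N -> (phi k < N)%N.
  exists (\max_(k < n) phi k).+1 => k kn; rewrite ltnS.
  exact: (leq_bigmax (Ordinal kn)).
have -> : \sum_(0 <= k < n) w k * u (phi k) =
    \sum_(0 <= k < n) \sum_(0 <= j < N) if phi k == j then w k * u j else 0.
  rewrite [LHS]big_nat [RHS]big_nat; apply: eq_bigr => k /andP[_ kn].
  rewrite (bigD1_seq (phi k)) ?iota_uniq ?mem_index_iota ?phiN//= eqxx.
  rewrite big1 ?addr0// => j; rewrite eq_sym => /negbTE ->//.
rewrite exchange_big/=; apply: le_trans (ler_wpM2l C0 (uc N)).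
rewrite mulr_sumr; apply: ler_sum => j _.
by rewrite -big_mkcond/= -mulr_suml ler_wpM2r.
Qed.

Lemma weighted_reindex_bounded (r0 : R) (q : \bar R) phi w (C : R) : 0 < r0 -> (r0%:E <= q)%E ->
  (forall j m, \sum_(0 <= k < m | phi k == j) `|w k| `^ r0 <= C) ->
  lp_bounded q (weighted_reindex phi w).
Proof.
move=> r00 rq wC.
have C0 : 0 <= C by have := wC 0%N 0%N; rewrite big_geq.
have w1 k : `|w k| `^ r0 <= C.
  apply: le_trans (wC (phi k) k.+1).
  rewrite big_mkcond big_nat_recr//= eqxx lerDr; apply: sumr_ge0 => i _.
  by case: ifP => // _; exact: powR_ge0.
pose M := C `^ r0^-1; have M0 : 0 <= M by exact: powR_ge0.
have wM k : `|w k| <= M.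
  by rewrite -(powR_le r00)// /M -powRrM mulVf ?gt_eqF// powRr1.
have q0 : (0 < q)%E by apply: lt_le_trans rq; rewrite lte_fin.
case: q rq q0 => [s||]// rs s0; last first.
  exists (M + 1); first by rewrite ltr_wpDl.
  move=> z; apply: lp_qnorm_le => //; first by rewrite ltr_wpDl.
  move=> c c0 H k; rewrite normrM; apply: ler_pM => //.
    by apply: le_trans (wM k) _; rewrite lerDl.
rewrite lee_fin in rs; rewrite lte_fin in s0.
pose D := M `^ (s - r0) * C + 1.
have D0 : 0 < D by rewrite ltr_wpDl// mulr_ge0 ?powR_ge0.
exists (D `^ s^-1); first exact: powR_gt0.
move=> z; apply: lp_qnorm_le; rewrite ?lte_fin ?powR_gt0// => c c0 H n.
rewrite powRM ?powR_ge0// -powRrM mulVf ?gt_eqF// powRr1 ?(ltW D0)//.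
apply: (@le_trans _ _ (M `^ (s - r0) * (\sum_(0 <= k < n) `|w k| `^ r0 * `|z (phi k)| `^ s))).
  rewrite mulr_sumr; apply: ler_sum => k _; rewrite normrM powRM// mulrA ler_wpM2r ?powR_ge0//.
  have -> : `|w k| `^ s = `|w k| `^ (s - r0) * `|w k| `^ r0.
    by rewrite mulrC -powRD_ge0 ?subr_ge0// addrC subrK.
  rewrite ler_wpM2r ?powR_ge0//.
  by rewrite ge0_ler_powR ?subr_ge0 ?nnegrE.
apply: (@le_trans _ _ (M `^ (s - r0) * (C * c `^ s))).
  rewrite ler_wpM2l ?powR_ge0//.
  exact: (@sum_reindex_le phi (fun k => `|w k| `^ r0) (fun k => `|z k| `^ s) C (c `^ s) n
    C0 (fun k => powR_ge0 _ _) wC H).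
by rewrite mulrA ler_wpM2r ?powR_ge0// lerDl.
Qed.

Definition block_sum (J : nat -> pred nat) (m : nat -> nat) (c : nat -> nat -> R) z : nat -> R :=
  fun k => \sum_(0 <= j < m k | J k j) c k j * z j.

Lemma block_sum_lin J m c : lin (block_sum J m c).
Proof.
move=> a x y; apply/funext => k; rewrite /block_sum.
have -> : (a *: (fun k => \sum_(0 <= j < m k | J k j) c k j * x j) +
   (fun k => \sum_(0 <= j < m k | J k j) c k j * y j)) k =
  a * (\sum_(0 <= j < m k | J k j) c k j * x j) + \sum_(0 <= j < m k | J k j) c k j * y j by [].
rewrite mulr_sumr -big_split/=; apply: eq_bigr => j _.
have -> : (a *: x + y) j = a * x j + y j by [].
by rewrite mulrDr mulrCA.
Qed.

Lemma sum_disjoint_le (J : nat -> pred nat) (m : nat -> nat) (u : nat -> R) (c : R) n :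
  (forall k k' j, J k j -> J k' j -> k = k') -> (forall k, 0 <= u k) ->
  (forall l, \sum_(0 <= k < l) u k <= c) ->
  \sum_(0 <= k < n) \sum_(0 <= j < m k | J k j) u j <= c.
Proof.
move=> Jdisj u0 uc.
have [N mN] : exists N, forall k, (k < n)%N -> (m k <= N)%N.
  by exists (\max_(k < n) m k) => k kn; exact: (leq_bigmax (Ordinal kn)).
apply: (@le_trans _ _ (\sum_(0 <= k < n) \sum_(0 <= j < N) if J k j then u j else 0)).
  rewrite big_nat [leRHS]big_nat; apply: ler_sum => k /andP[_ kn].
  by rewrite big_mkcond/=; apply: sum_mono (mN k kn) => j; case: ifP.
rewrite exchange_big/=; apply: le_trans (uc N); apply: ler_sum => j _.
rewrite -big_mkcond/=; apply: (@sum_uniq_le R (fun k => J k j)) => // k k'.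
exact: Jdisj.
Qed.

(** The embedding of [l^s] into [l^1], for [s <= 1]. *)
Lemma powR_sum_le (s : R) (P : pred nat) (u : nat -> R) n :
  0 < s -> s <= 1 -> (forall k, 0 <= u k) ->
  (\sum_(0 <= k < n | P k) u k) `^ s <= \sum_(0 <= k < n | P k) u k `^ s.
Proof.
move=> s0 s1 u0; rewrite [X in X `^ s]big_mkcond [leRHS]big_mkcond/=.
pose v k := if P k then u k else 0.
have v0 k : 0 <= v k by rewrite /v; case: ifP.
have -> : \sum_(0 <= k < n) (if P k then u k `^ s else 0) = \sum_(0 <= k < n) v k `^ s.
  by apply: eq_bigr => k _; rewrite /v; case: ifP => //; rewrite powR0 ?gt_eqF.
rewrite -/(v _); set S := \sum_(0 <= k < n) v k `^ s.
have S0 : 0 <= S by apply: sumr_ge0 => k _; exact: powR_ge0.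
pose z k := if (k < n)%N then v k else 0.
have zS : lp_le s%:E z (S `^ s^-1).
  apply: lp_le_root => // m; have [mn|/ltnW nm] := leqP m n.
    apply: le_trans (sum_mono (fun k => powR_ge0 (v k) s) mn).
    rewrite big_nat [leRHS]big_nat; apply: ler_sum => k /andP[_ km].
    by rewrite /z (leq_trans km mn) ger0_norm.
  rewrite (big_cat_nat (n:=n) (p:=m))//= [X in _ + X](_ : _ = 0) ?addr0; last first.
    rewrite big_nat big1// => k /andP[nk _].
    by rewrite /z ltnNge nk normr0 powR0 ?gt_eqF.
  rewrite big_nat [leRHS]big_nat; apply: ler_sum => k /andP[_ kn].
  by rewrite /z kn ger0_norm.
have s1' : (s%:E <= 1%:E)%E by rewrite lee_fin.
have s0' : (0 < s%:E)%E by rewrite lte_fin.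
have := lp_le_embed s0' s1' (powR_ge0 _ _) zS => /(_ n).
rewrite powRr1 ?powR_ge0// => H.
have -> : \sum_(0 <= i < n) (if P i then u i else 0) = \sum_(0 <= k < n) `|z k| `^ 1.
  rewrite big_nat [RHS]big_nat; apply: eq_bigr => k /andP[_ kn].
  by rewrite /z kn powRr1 ?normr_ge0// ger0_norm// v0.
apply: le_trans (_ : (S `^ s^-1) `^ s <= _); last first.
  by rewrite -powRrM mulVf ?gt_eqF// powRr1.
apply: ge0_ler_powR; rewrite ?nnegrE ?powR_ge0 ?(ltW s0)//.
by apply: sumr_ge0 => k _; exact: powR_ge0.
Qed.

(** On disjoint blocks, a functional bounded by the [l^q] quasi-norm of the block is also
    bounded by its [l^p] quasi-norm, the smaller exponent giving the larger quasi-norm. *)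
Lemma block_sum_bounded (p q : R) (J : nat -> pred nat) m c (D : R) : 0 < p -> p <= q -> 0 < D ->
  (forall k k' j, J k j -> J k' j -> k = k') ->
  (forall z k, `|block_sum J m c z k| `^ q <= D * \sum_(0 <= j < m k | J k j) `|z j| `^ q) ->
  lp_bounded p%:E (block_sum J m c).
Proof.
move=> p0 pq D0 Jdisj H; have q0 : 0 < q by exact: lt_le_trans pq.
pose s := p / q; have s0 : 0 < s by rewrite divr_gt0.
have s1 : s <= 1 by rewrite ler_pdivrMr// mul1r.
have qs : q * s = p by rewrite /s mulrC divfK// gt_eqF.
exists (D `^ q^-1); first exact: powR_gt0.
move=> z; apply: lp_qnorm_le; rewrite ?lte_fin ?powR_gt0// => C C0 zC n.
rewrite powRM ?powR_ge0// -powRrM [q^-1 * p]mulrC -/s.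
apply: (@le_trans _ _ (D `^ s * \sum_(0 <= k < n) \sum_(0 <= j < m k | J k j) `|z j| `^ p)).
  rewrite mulr_sumr; apply: ler_sum => k _.
  rewrite -{1}qs powRrM.
  apply: (@le_trans _ _ ((D * \sum_(0 <= j < m k | J k j) `|z j| `^ q) `^ s)).
    rewrite powR_le ?powR_ge0// mulr_ge0 ?(ltW D0)//; apply: sumr_ge0 => j _; exact: powR_ge0.
  rewrite powRM ?(ltW D0)//; last by apply: sumr_ge0 => j _; exact: powR_ge0.
  rewrite ler_wpM2l ?powR_ge0//.
  apply: le_trans (@powR_sum_le s (J k) (fun j => `|z j| `^ q) (m k) s0 s1
    (fun j => powR_ge0 _ _)) _.
  by rewrite le_eqVlt; apply/orP; left; apply/eqP; apply: eq_bigr => j _; rewrite -powRrM qs.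
rewrite ler_wpM2l ?powR_ge0//; apply: sum_disjoint_le => // k; exact: powR_ge0.
Qed.

(** Jensen's inequality up to a factor [2], from [v <= l (1 + (v / l) ^ q)] with [l] the
    mean of order [q]; here [q >= 1] is essential. *)
Lemma weighted_mean_le (q : R) (P : pred nat) (w v : nat -> R) n : 1 <= q ->
  (forall j, 0 <= w j) -> (forall j, 0 <= v j) -> \sum_(0 <= j < n | P j) w j <= 1 ->
  (\sum_(0 <= j < n | P j) w j * v j) `^ q <= 2 `^ q * \sum_(0 <= j < n | P j) w j * v j `^ q.
Proof.
move=> q1 w0 v0 w1; have q0 : 0 < q by exact: lt_le_trans q1.
set V := \sum_(0 <= j < n | P j) w j * v j `^ q.
have V0 : 0 <= V by apply: sumr_ge0 => j _; rewrite mulr_ge0 ?powR_ge0.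
pose l := V `^ q^-1; have lq : l `^ q = V by rewrite /l -powRrM mulVf ?gt_eqF// powRr1.
have l0 : 0 <= l by exact: powR_ge0.
rewrite -lq -powRM// powR_le//; last 2 first.
- by apply: sumr_ge0 => j _; rewrite mulr_ge0.
- by rewrite mulr_ge0.
(* If the mean of order [q] vanishes, so do all the terms. *)
have [lz|lz] := eqVneq l 0.
  have Vz : V = 0 by rewrite -lq lz powR0 ?gt_eqF.
  rewrite lz mulr0 big_seq_cond big1// => j /andP[jn Pj].
  have [->|wj] := eqVneq (w j) 0; first by rewrite mul0r.
  have : w j * v j `^ q <= 0.
    rewrite -Vz /V big_mkcond (bigD1_seq j)//= ?iota_uniq// Pj lerDl.
    by apply: sumr_ge0 => i _; case: ifP => // _; rewrite mulr_ge0 ?powR_ge0.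
  rewrite pmulr_rle0 ?lt_neqAle ?(eq_sym 0) ?wj ?w0// => vj.
  have /eqP : v j `^ q = 0 by apply/eqP; rewrite eq_le vj powR_ge0.
  by rewrite powR_eq0 => /andP[/eqP -> _]; rewrite mulr0.
have lpos : 0 < l by rewrite lt_neqAle eq_sym lz.
have vl j : v j <= l * (1 + v j `^ q / V).
  have E : v j `^ q / V = (v j / l) `^ q.
    rewrite powRM ?invr_ge0// -lq; congr (_ * _).
    have lq0 : l `^ q != 0 by rewrite gt_eqF// powR_gt0.
    have El : l^-1 `^ q * l `^ q = 1.
      by rewrite -(powRM q) ?invr_ge0// (mulVf lz) powR1.
    by apply: (mulIf lq0); rewrite El (mulVf lq0).
  rewrite -ler_pdivrMl// mulrC E.
  have [vl1|vl1] := leP (v j / l) 1; first by rewrite (le_trans vl1)// lerDl powR_ge0.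
  by rewrite (le_trans (le1r_powR (ltW vl1) q1))// lerDr.
have Vpos : 0 < V by rewrite -lq powR_gt0.
apply: (@le_trans _ _ (\sum_(0 <= j < n | P j) (l * w j + l / V * (w j * v j `^ q)))).
  apply: ler_sum => j _; apply: le_trans (ler_wpM2l (w0 j) (vl j)) _.
  by rewrite le_eqVlt; apply/orP; left; apply/eqP; field; rewrite gt_eqF.
rewrite big_split/= -!mulr_sumr -/V divfK ?gt_eqF//.
have : l * \sum_(0 <= j < n | P j) w j <= l * 1 by rewrite ler_wpM2l.
by lra.
Qed.
End operators.

(** * Rearrangements and power sums *)
Section sorting.
Context (R : realType).
Implicit Types (x y z : nat -> R).

Lemma two_to_one_fiber (phi : nat -> nat) (P : pred nat) (r : nat -> R) (p : R) : 0 < p ->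
  (forall k k', P k -> P k' -> phi k = phi k' -> k = k') ->
  (forall k k', ~~ P k -> ~~ P k' -> phi k = phi k' -> k = k') ->
  (forall k, `|r k| <= 4) ->
  forall j m, \sum_(0 <= k < m | phi k == j) `|r k| `^ p <= 2 * 4 `^ p.
Proof.
move=> p0 P1 P2 r4 j m; rewrite (bigID P)/= mulrDl mul1r.
have r4p k : `|r k| `^ p <= 4 `^ p by rewrite powR_le.
apply: lerD; apply: sum_uniq_le; rewrite ?powR_ge0// => k k'.
  by move=> /andP[/eqP kj Pk] /andP[/eqP k'j Pk']; apply: P1 => //; rewrite kj k'j.
by move=> /andP[/eqP kj Pk] /andP[/eqP k'j Pk']; apply: P2 => //; rewrite kj k'j.
Qed.

(** Each [s n] nearly maximizes [|z|] among the indices that have not been chosen yet. The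
    indices that are never chosen have entries below twice each chosen one. *)
Lemma greedy_enumeration z (B : R) : (forall k, `|z k| <= B) ->
  exists s : nat -> nat, [/\ injective s, forall m n, (m <= n)%N -> `|z (s n)| <= 2 * `|z (s m)| &
    forall k, (forall n, s n <> k) -> forall n, `|z k| <= 2 * `|z (s n)|].
Proof.
move=> zB.
have /choice[f fP] (l : seq nat) : exists m,
    m \notin l /\ forall i, i \notin l -> `|z i| <= 2 * `|z m|.
  have [||m ml H] := @exists_half_max R nat (fun i => i \notin l) (fun i => `|z i|) B.
  - exists (\max_(i <- l) i).+1; apply/negP => H.
    by have := @leq_bigmax_seq _ l predT id _ H isT; rewrite ltnn.
  - by move=> i _; rewrite normr_ge0 zB.
  - by exists m.
(* The list of the first [n] choices. *)
pose l n := iter n (fun l => rcons l (f l)) [::].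
pose s n := f (l n).
have lS n : l n.+1 = rcons (l n) (s n) by [].
have sl n : s n \notin l n by have [] := fP (l n).
have memS i n : (i < n)%N -> s i \in l n.
  elim: n => // n IH; rewrite ltnS leq_eqVlt => /predU1P[->|/IH H].
    by rewrite lS mem_rcons inE eqxx.
  by rewrite lS mem_rcons inE H orbT.
have notin k n : (forall m, (m < n)%N -> s m <> k) -> k \notin l n.
  elim: n => // n IH H; rewrite lS mem_rcons inE negb_or; apply/andP; split.
    by apply/eqP => kE; exact: (H n (ltnSn n)).
  by apply: IH => m mn; apply: H; exact: ltnW.
exists s; split.
- move=> i j sij; have [ij|ji|//] := ltngtP i j.
    by have := sl j; rewrite -sij memS.
  by have := sl i; rewrite sij memS.
- move=> m n mn; have [_] := fP (l m); apply.
  by apply: notin => i im; apply/eqP/negP => /eqP E; have := sl n; rewrite -E memS// (leq_trans im).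
- by move=> k ks n; have [_] := fP (l n); apply; apply: notin => m _; exact: ks.
Qed.

Fixpoint running_min (u : nat -> R) n : R :=
  if n is m.+1 then Num.min (running_min u m) (u m.+1) else u 0%N.

(** A substitute for the decreasing rearrangement, which is the image of [z] under an
    operator and has [z] as its image under another one. For bounded sequences that do
    not tend to zero, the entries that the enumeration never reaches are recovered from
    the sorted sequence at the same index; so each sorted entry is used at most twice. *)
Lemma almost_sorted z (B : R) : (forall k, `|z k| <= B) ->
  exists zt phi1 r1 phi2 r2, [/\ (forall k, 0 <= zt k) /\ (forall m n, (m <= n)%N -> zt n <= zt m),
    zt = weighted_reindex phi1 r1 z, z = weighted_reindex phi2 r2 zt &
    forall p, 0 < p ->
      (forall j m, \sum_(0 <= k < m | phi1 k == j) `|r1 k| `^ p <= 2 * 4 `^ p) /\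
      (forall j m, \sum_(0 <= k < m | phi2 k == j) `|r2 k| `^ p <= 2 * 4 `^ p)].
Proof.
move=> /greedy_enumeration[s [sinj smono scov]].
pose zt := running_min (fun n => `|z (s n)|).
have zt0 k : 0 <= zt k by elim: k => [|k IH] /=; rewrite ?le_min ?IH normr_ge0.
have ztmono m n : (m <= n)%N -> zt n <= zt m.
  move=> /subnKC <-; elim: (n - m)%N => [|l IH]; first by rewrite addn0.
  by rewrite addnS; apply: le_trans IH; rewrite ge_min lexx.
have zts n : zt n <= `|z (s n)| by case: n => [|n] //=; rewrite ge_min lexx orbT.
have szt m n : (m <= n)%N -> `|z (s n)| <= 2 * zt m.
  elim: m => [|m IH] mn; first by have := smono 0%N n mn.
  have -> : zt m.+1 = Num.min (zt m) `|z (s m.+1)| by [].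
  by rewrite /Num.min; case: ifP => _; [apply: IH; exact: ltnW|exact: smono].
have /choice[phi2 phi2P] k : exists i, s i = k \/ (i = k /\ forall n, s n <> k).
  have [[n nk]|H] := pselect (exists n, s n = k); first by exists n; left.
  by exists k; right; split=> // n nk; apply: H; exists n.
have zle k : `|z k| <= 4 * zt (phi2 k).
  have [sk|[kE H]] := phi2P k.
    by have := szt _ _ (leqnn (phi2 k)); rewrite sk; have := zt0 (phi2 k); lra.
  rewrite kE; have := scov k H k; have := szt _ _ (leqnn k); lra.
have ratio (a b : R) (c : R) : 0 <= c -> `|a| <= c * `|b| -> a = a / b * b /\ `|a / b| <= c.
  move=> c0; have [->|b0] := eqVneq b 0.
    by rewrite normr0 mulr0 normr_le0 => /eqP ->; rewrite !mul0r normr0.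
  by move=> ab; rewrite divfK//; split=> //; rewrite normf_div ler_pdivrMr ?normr_gt0.
exists zt, s, (fun k => zt k / z (s k)), phi2, (fun k => z k / zt (phi2 k)).
have H1 k := ratio (zt k) (z (s k)) 1 ler01.
have H2 k := ratio (z k) (zt (phi2 k)) 4 (ler0n R 4).
split=> //.
- by apply/funext => k; rewrite /weighted_reindex; apply: (H1 k _).1; rewrite mul1r ger0_norm.
- by apply/funext => k; rewrite /weighted_reindex; apply: (H2 k _).1; rewrite (ger0_norm (zt0 _)).
- move=> p p0; split.
    apply: (@two_to_one_fiber s predT) => // [k k' _ _|k]; first exact: sinj.
    have [|_] := H1 k; first by rewrite mul1r ger0_norm.
    by move=> H; apply: le_trans H _; rewrite ler1n.
  apply: (@two_to_one_fiber phi2 (fun k => s (phi2 k) == k)) => //.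
  + by move=> k k' /eqP {2}<- /eqP {2}<- ->.
  + move=> k k' /eqP Hk /eqP Hk'.
    by have [//|[-> _]] := phi2P k; have [//|[-> _]] := phi2P k'.
  + by move=> k; have [|_] := H2 k; rewrite ?(ger0_norm (zt0 _)).
Qed.
End sorting.

Section power_sums.
Context (R : realType).

Lemma sum_const_le (u : nat -> R) (c : R) n : (forall k, (k < n)%N -> c <= u k) ->
  n%:R * c <= \sum_(0 <= k < n) u k.
Proof.
move=> H; rewrite -[n in n%:R]subn0 mulr_natl -sumr_const_nat big_nat [leRHS]big_nat.
by apply: ler_sum => k /andP[_ kn]; exact: H.
Qed.

(** From [y <= |a| + |b|], as [|b| ^ p <= 1 + |b| ^ q] and the [1] is summed [n] times. *)
Lemma head_sum_bound (p q M : R) : 0 < p -> p < q -> 0 < M -> exists2 C : R, 0 < C &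
  forall n (y a b : nat -> R), (forall k, 0 <= y k) ->
  (forall k, y k <= `|a k| + `|b k|) ->
  (\sum_(0 <= k < n) `|a k| `^ p <= M * n%:R) ->
  (\sum_(0 <= k < n) `|b k| `^ q <= M * n%:R) ->
  \sum_(0 <= k < n) y k `^ p <= C * n%:R.
Proof.
move=> p0 pq M0; exists (2 `^ p * (M + (1 + M))).
  by rewrite mulr_gt0 ?powR_gt0// addr_gt0// addr_gt0.
move=> n y a b y0 yab ap bq.
apply: (@le_trans _ _ (\sum_(0 <= k < n) 2 `^ p * (`|a k| `^ p + (1 + `|b k| `^ q)))).
  apply: ler_sum => k _.
  apply: (@le_trans _ _ ((`|a k| + `|b k|) `^ p)); first by rewrite powR_le ?addr_ge0.
  apply: le_trans (powR_add_le p0 _ _) _ => //.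
  rewrite ler_wpM2l ?powR_ge0// lerD2l.
  have [b1|b1] := leP `|b k| 1.
    apply: (@le_trans _ _ 1); last by rewrite lerDl powR_ge0.
    by have := powR_le p0 (normr_ge0 (b k)) (@ler01 R); rewrite powR1 b1.
  apply: (@le_trans _ _ (`|b k| `^ q)); last by rewrite lerDr.
  by apply: ler_powR; rewrite ltW.
rewrite -mulr_sumr -mulrA ler_wpM2l ?powR_ge0// !big_split/= !mulrDl lerD// lerD//.
by rewrite mul1r sumr_const_nat subn0.
Qed.

(** The head bound and monotonicity give [y k <= h] for [k >= n], with [h] independent of
    [n]. Where [|a k|] is at least half of [y k], this turns [y k ^ q] into a multiple of
    [|a k| ^ p]; elsewhere [y k] is at most [2 |b k|]. *)
Lemma tail_sum_bound (p q M : R) : 0 < p -> p < q -> 0 < M -> exists2 C : R, 0 < C &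
  forall n (y a b : nat -> R), (0 < n)%N -> (forall k, 0 <= y k) ->
  (forall k l, (k <= l)%N -> y l <= y k) ->
  (forall k, y k <= `|a k| + `|b k|) ->
  (forall m, \sum_(0 <= k < m) `|a k| `^ p <= M * n%:R) ->
  (forall m, \sum_(0 <= k < m) `|b k| `^ q <= M * n%:R) ->
  forall m, \sum_(n <= k < m) y k `^ q <= C * n%:R.
Proof.
move=> p0 pq M0; have q0 : 0 < q by exact: lt_trans pq.
have [C1 C10 HC1] := head_sum_bound p0 pq M0.
pose h := C1 `^ p^-1; pose D := h `^ (q - p) * 2 `^ p + 2 `^ q.
have h0 : 0 <= h by exact: powR_ge0.
have D0 : 0 < D by rewrite ltr_wpDl ?powR_gt0// mulr_ge0 ?powR_ge0.
exists (D * (M + M)); first by rewrite mulr_gt0// addr_gt0.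
move=> n y a b n0 y0 ymono yab ap bq m.
have hp : h `^ p = C1 by rewrite /h -powRrM mulVf ?gt_eqF// powRr1// ltW.
have yh k : (n <= k)%N -> y k <= h.
  move=> nk; rewrite -(powR_le p0)// hp.
  rewrite -(@ler_pM2l _ n%:R) ?ltr0n// mulrC -[leRHS]mulrC mulrC.
  apply: le_trans (HC1 n y a b y0 yab (ap n) (bq n)).
  apply: sum_const_le => i ik; rewrite powR_le//.
  by apply: ymono; exact: leq_trans (ltnW ik) nk.
have yq k : (n <= k)%N -> y k `^ q <= D * (`|a k| `^ p + `|b k| `^ q).
  move=> nk; have [ya|ya] := leP (y k) (2 * `|a k|).
    apply: (@le_trans _ _ (h `^ (q - p) * 2 `^ p * `|a k| `^ p)).
      have -> : y k `^ q = y k `^ (q - p) * y k `^ p.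
        by rewrite mulrC -powRD_ge0 ?subr_ge0 ?(ltW pq)// addrC subrK.
      rewrite -mulrA -powRM//; apply: ler_pM; rewrite ?powR_ge0//.
        by apply: ge0_ler_powR; rewrite ?subr_ge0 ?(ltW pq) ?nnegrE ?yh.
      by rewrite powR_le ?mulr_ge0.
    rewrite /D mulrDl ler_wpDr ?mulr_ge0 ?addr_ge0 ?powR_ge0//.
    by rewrite ler_wpM2l ?mulr_ge0 ?powR_ge0// lerDl powR_ge0.
  have yb : y k <= 2 * `|b k| by have := yab k; lra.
  apply: (@le_trans _ _ (2 `^ q * `|b k| `^ q)).
    by rewrite -powRM// powR_le ?mulr_ge0.
  rewrite /D mulrDl ler_wpDl ?mulr_ge0 ?addr_ge0 ?powR_ge0//.
  by rewrite ler_wpM2l ?powR_ge0// lerDr powR_ge0.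
apply: (@le_trans _ _ (\sum_(n <= k < m) D * (`|a k| `^ p + `|b k| `^ q))).
  by rewrite big_nat [leRHS]big_nat; apply: ler_sum => k /andP[nk _]; exact: yq.
rewrite -mulr_sumr -mulrA ler_wpM2l ?(ltW D0)// big_split/= mulrDl.
have sub (u : nat -> R) : (forall k, 0 <= u k) -> \sum_(n <= k < m) u k <= \sum_(0 <= k < m) u k.
  move=> u0; have [nm|/ltnW mn] := leqP n m; last by rewrite big_geq// sumr_ge0.
  by rewrite [leRHS](big_cat_nat (n:=n) (p:=m))//= lerDr sumr_ge0.
by apply: lerD; [apply: le_trans (ap m)|apply: le_trans (bq m)]; apply: sub => k; exact: powR_ge0.
Qed.
End power_sums.

(** * Interpolation spaces are K-monotone *)
Section Calderon_Mityagin.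
Context (R : realType).
Variables (p : R) (q : \bar R).
Hypotheses (p_gt0 : 0 < p) (p_lt_q : (p%:E < q)%E).
Local Notation Np := (@lp_qnorm R p%:E).
Local Notation Nq := (@lp_qnorm R q).
Local Notation K := (Kfun Np Nq).
Local Notation sigma := (sigma_qnorm Np Nq).
Implicit Types (x y z : nat -> R) (T : (nat -> R) -> nat -> R).

Let p_gt0' : (0 < p%:E)%E. Proof. by rewrite lte_fin. Qed.
Let q_gt0 : (0 < q)%E. Proof. exact: lt_trans p_lt_q. Qed.
Let NpP := lp_lattice_qnorm p_gt0'.
Let NqP := lp_lattice_qnorm q_gt0.

(** An operator acts on decompositions. *)
Lemma Kfun_bounded T : lin T -> lp_bounded p%:E T -> lp_bounded q T ->
  exists2 D : R, 0 < D & forall t x, 0 <= t -> (K t (T x) <= D%:E * K t x)%E.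
Proof.
move=> Tlin [D0 D00 H0] [D1 D10 H1]; exists (D0 + D1); first exact: addr_gt0.
move=> t x t0; apply: Kfun_transfer => //; first exact: addr_gt0.
move=> a b c d -> ac bd c0 d0.
have -> : T (a + b) = T a + T b by have := Tlin 1 a b; rewrite !scale1r.
apply: (@le_trans _ _ (D0 * c + t * (D1 * d))%:E).
  apply: Kfun_le => //.
    by apply: le_trans (H0 a) _; rewrite ac -EFinM.
  by apply: le_trans (H1 b) _; rewrite bd -EFinM.
rewrite lee_fin mulrDr !mulrDl addrACA -[leLHS]addr0 [X in X + 0](_ : _ = D0 * c + D1 * (t * d)).
  rewrite -addrA; have := mulr_ge0 (ltW D10) c0.
  by have := mulr_ge0 (ltW D00) (mulr_ge0 t0 d0); lra.
by rewrite mulrCA.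
Qed.

Lemma lq_of_sigma : exists2 C : R, 0 < C &
  forall y (r : R), 0 <= r -> (K 1 y < r%:E)%E -> lp_le q y (C * r).
Proof.
have [C C0 HC] := lp_le_add q_gt0; exists (C * 2); first exact: mulr_gt0.
move=> y r r0 /(Kfun_lt NpP NqP)[a [b [c [d [-> ac bd [c0 d0] cd]]]]].
rewrite mul1r in cd; have cr : c <= r by lra.
have dr : d <= r by lra.
rewrite -mulrA mulr_natl mulr2n; apply: HC => //.
  apply: (lp_le_embed p_gt0' (ltW p_lt_q) r0); apply/lp_leP => //.
  by rewrite ac lee_fin.
by apply/lp_leP => //; rewrite bd lee_fin.
Qed.

Section operators_act.
Variable NX : (nat -> R) -> \bar R.
Hypotheses (XP : sequence_lattice NX) (Xint : interpolation_space Np Nq NX).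

Lemma interpolation_lin T x : lin T -> lp_bounded p%:E T -> lp_bounded q T ->
  (NX x < +oo)%E -> (NX (T x) < +oo)%E.
Proof.
move=> Tlin Tp Tq xfin; have [D D0 HD] := Kfun_bounded Tlin Tp Tq.
have [_ _ H] := Xint; have NXq := proj1 (proj1 XP); have [Nge _ _ _] := NXq.
have [|||C [C0 HC]] := H T _.
- split; last by move=> a u v _ _; exact: Tlin.
  move=> u; rewrite !sigmaE => /(ge0_is_fin_num (Kfun_ge0 NpP NqP _ ler01))[c c0 uc].
  by apply: le_lt_trans (HD 1 u ler01) _; rewrite uc -EFinM ltry.
- by have [C C0 HC] := Tp; exists C.
- by have [C C0 HC] := Tq; exists C.
apply: le_lt_trans (HC x xfin) _.
by have [c c0 ->] := ge0_is_fin_num (Nge _) xfin; rewrite -EFinM ltry.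
Qed.

Lemma reindex_act phi w (C : R) x :
  (forall j m, \sum_(0 <= k < m | phi k == j) `|w k| `^ p <= C) ->
  (NX x < +oo)%E -> (NX (weighted_reindex phi w x) < +oo)%E.
Proof.
move=> wC; apply: interpolation_lin; first exact: weighted_reindex_lin.
  exact: weighted_reindex_bounded wC.
exact: weighted_reindex_bounded (ltW p_lt_q) wC.
Qed.

(** The hypotheses are those of bin packing for the [p]-th powers. So [u] is an image of
    [x]: each entry of [u] is a multiple of the entry of [x] to which [head_assignment]
    attaches it. *)
Lemma head_majorized_act x u (C : R) : 0 < C -> (forall k, 0 <= x k) ->
  (forall k l, (k <= l)%N -> x l <= x k) -> (forall k, 0 <= u k) ->
  (forall n, \sum_(0 <= k < n) u k `^ p <= C * \sum_(0 <= k < n) x k `^ p) ->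
  (forall k, k.+1%:R * u k `^ p <= C * \sum_(0 <= i < k.+1) x i `^ p) ->
  (NX x < +oo)%E -> (NX u < +oo)%E.
Proof.
move=> C0 x0 xmono u0 ux ku xfin.
have [|||||phi Hphi] := @head_assignment R (fun k => u k `^ p / C) (fun k => x k `^ p).
- by move=> k; rewrite divr_ge0 ?powR_ge0 ?ltW.
- by move=> k; exact: powR_ge0.
- by move=> m n mn; rewrite powR_le// xmono.
- by move=> n; rewrite -mulr_suml ler_pdivrMr// mulrC.
- by move=> k; rewrite mulrA ler_pdivrMr// [leRHS]mulrC.
have up k : u k `^ p <= 4 * C * x (phi k) `^ p.
  have := Hphi (phi k) k.+1; rewrite big_mkcond big_nat_recr//= eqxx => H.
  have : u k `^ p / C <= 4 * x (phi k) `^ p.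
    apply: le_trans H; rewrite lerDr; apply: sumr_ge0 => i _.
    by case: ifP => // _; rewrite divr_ge0 ?powR_ge0 ?ltW.
  by rewrite ler_pdivrMr// mulrAC.
have ux0 k : x (phi k) = 0 -> u k = 0.
  move=> xz; have := up k; rewrite xz powR0 ?gt_eqF// mulr0 => H.
  have /eqP : u k `^ p = 0 by apply/eqP; rewrite eq_le H powR_ge0.
  by rewrite powR_eq0 => /andP[/eqP].
pose w k := u k / x (phi k).
have -> : u = weighted_reindex phi w x.
  apply/funext => k; rewrite /weighted_reindex /w.
  by have [xz|xz] := eqVneq (x (phi k)) 0; [rewrite (ux0 k xz) xz mulr0|rewrite divfK].
apply: (@reindex_act phi w (4 * C)) => // j m.
have [xz|xz] := eqVneq (x j) 0.
  rewrite big1 ?mulr_ge0 ?(ltW C0)// => k /eqP kj.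
  by rewrite /w ux0 ?kj// mul0r normr0 powR0 ?gt_eqF.
have xj : 0 < x j `^ p by rewrite powR_gt0// lt_neqAle eq_sym xz x0.
rewrite -(ler_pM2r xj) mulr_suml mulrAC -ler_pdivrMr//.
apply: le_trans (Hphi j m); rewrite mulr_suml le_eqVlt; apply/orP; left; apply/eqP.
apply: eq_bigr => k /eqP kj; rewrite /w kj; congr (_ / _).
by rewrite -powRM ?normr_ge0// normf_div [`|x j|]ger0_norm// divfK// ger0_norm.
Qed.

(** Let the tails of the [s]-th powers of [v] be below those of [x]. Where [v] is not much
    larger than [x], it is obtained by a diagonal operator. The other entries [v k] are
    weighted means of the entries of [x] in disjoint blocks, which are bounded by the
    [l^s] quasi-norms of the blocks since [s >= 1]. *)
Lemma tail_majorized_act (s : R) x v (Q : nat -> R) (C : R) : q = s%:E -> 1 <= s -> 0 < C ->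
  (forall k, 0 <= x k) -> (forall k l, (k <= l)%N -> x l <= x k) -> (forall k, 0 <= v k) ->
  (forall n, Q n = x n `^ s + Q n.+1) -> (forall e, 0 < e -> exists n, Q n < e) ->
  (forall n m, \sum_(n <= k < m) v k `^ s <= C * Q n) ->
  (NX x < +oo)%E -> (NX v < +oo)%E.
Proof.
move=> qs s1 C0 x0 xmono v0 QS Qlim vQ xfin.
have s0 : 0 < s by exact: lt_le_trans s1.
pose a k := v k `^ s / C; pose b k := x k `^ s.
have a0 k : 0 <= a k by rewrite divr_ge0 ?powR_ge0 ?ltW.
have b0 k : 0 <= b k by exact: powR_ge0.
have bmono m n : (m <= n)%N -> b n <= b m by move=> mn; rewrite powR_le// xmono.
have aQ n m : \sum_(n <= k < m) a k <= Q n by rewrite -mulr_suml ler_pdivrMr// mulrC.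
have [A [AS A0 _ AQ]] := tail_sums a0 (aQ 0%N).
have AB n : A n <= Q n by apply: AQ.
have /choice[m mP] k : exists m, 4 * b k < a k ->
    (forall j, tail_block a A Q k j -> (j < m)%N) /\
    a k / 4 <= \sum_(0 <= j < m | tail_block a A Q k j) b j.
  have [ab|] := ltP (4 * b k) (a k); last by exists 0%N.
  by have [m [Hm1 Hm2]] := tail_block_sum a0 b0 bmono AS A0 QS Qlim AB ab; exists m.
pose J k := [pred j | (4 * b k < a k) && tail_block a A Q k j].
have Jdisj k k' j : J k j -> J k' j -> k = k'.
  by move=> /andP[_ H] /andP[_ H']; exact: tail_block_disjoint a0 AS H H'.
pose S k := \sum_(0 <= j < m k | J k j) b j.
have SE k : 4 * b k < a k -> a k / 4 <= S k.
  move=> ab; have [_] := mP k ab; congr (_ <= _); apply: eq_bigl => j.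
  by rewrite /= ab.
pose c k j := v k * (b j / S k / x j).
pose w k := if 4 * b k < a k then 0 else v k / x k.
have bx j : x j = 0 -> b j = 0 by rewrite /b => ->; rewrite powR0 ?gt_eqF.
have va k : v k `^ s = C * a k by rewrite /a mulrC divfK ?gt_eqF.
have -> : v = weighted_reindex id w x + block_sum J m c x.
  apply/funext => k.
  have -> : (weighted_reindex id w x + block_sum J m c x) k = w k * x k + block_sum J m c x k by [].
  rewrite /w /block_sum; case: ifPn => [ab|ab].
    have Spos : 0 < S k by apply: lt_le_trans (SE k ab); have := b0 k; lra.
    rewrite mul0r add0r (eq_bigr (fun j => v k / S k * b j)); last first.
      move=> j _; rewrite /c; have [xz|xz] := eqVneq (x j) 0.
        by rewrite xz (bx j xz) !mulr0.
      by field; rewrite xz gt_eqF.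
    by rewrite -mulr_sumr -/(S k) divfK ?gt_eqF.
  rewrite big_pred0 ?addr0; last by move=> j; rewrite /= (negbTE ab).
  have [xz|xz] := eqVneq (x k) 0; last by rewrite divfK.
  rewrite xz mulr0; move: ab; rewrite -leNgt (bx k xz) mulr0 => ak.
  have /eqP : v k `^ s = 0 by rewrite va; apply/eqP; rewrite mulf_eq0 (gt_eqF C0)/= eq_le ak a0.
  by rewrite powR_eq0 => /andP[/eqP].
have NXq := proj1 (proj1 XP); have [Nge _ _ [CX [_ HX]]] := NXq.
apply: le_lt_trans (HX _ _) _.
suff [H1 H2] : (NX (weighted_reindex id w x) < +oo)%E /\ (NX (block_sum J m c x) < +oo)%E.
  have [d1 _ ->] := ge0_is_fin_num (Nge _) H1; have [d2 _ ->] := ge0_is_fin_num (Nge _) H2.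
  by rewrite -EFinD -EFinM ltry.
split.
  apply: (@reindex_act id w (((4 * C) `^ s^-1) `^ p)) => // j n.
  have wk k : `|w k| `^ p <= ((4 * C) `^ s^-1) `^ p.
    rewrite powR_le ?powR_ge0// -(powR_le s0) ?powR_ge0// -powRrM mulVf ?gt_eqF//.
    rewrite powRr1; last first.
      by rewrite mulr_ge0// ltW.
    rewrite /w; case: ifPn => [_|]; first by rewrite normr0 powR0 ?gt_eqF// mulr_ge0// ltW.
    rewrite -leNgt => ab; have [xz|xz] := eqVneq (x k) 0.
      by rewrite xz invr0 mulr0 normr0 powR0 ?gt_eqF// mulr_ge0// ltW.
    have xk : 0 < b k by rewrite powR_gt0// lt_neqAle eq_sym xz x0.
    rewrite -(ler_pM2r xk) /b -powRM ?normr_ge0// normf_div [`|x k|]ger0_norm// divfK//.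
    by rewrite ger0_norm// va [4 * C]mulrC -mulrA ler_pM2l.
  by apply: sum_uniq_le; rewrite ?powR_ge0// => k k' /eqP -> /eqP ->.
have blockD z k : `|block_sum J m c z k| `^ s <=
    2 `^ s * (4 * C) * \sum_(0 <= j < m k | J k j) `|z j| `^ s.
  have [ab|ab] := ltP (4 * b k) (a k); last first.
    rewrite /block_sum !big_pred0 ?mulr0 ?normr0 ?powR0 ?gt_eqF//;
      by move=> j; rewrite /= ltNge ab.
  have Sk := SE k ab.
  have Spos : 0 < S k by apply: lt_le_trans Sk; have := b0 k; lra.
  have h : `|block_sum J m c z k| <= v k * \sum_(0 <= j < m k | J k j) (b j / S k) * (`|z j| / x j).
    apply: le_trans (ler_norm_sum _ _ _) _; rewrite mulr_sumr le_eqVlt; apply/orP; left; apply/eqP.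
    apply: eq_bigr => j _; rewrite /c !normrM normfV (ger0_norm (v0 k)) (ger0_norm (b0 j)).
    rewrite normfV (ger0_norm (x0 j)) (gtr0_norm Spos); ring.
  have bS j : 0 <= b j / S k by rewrite divr_ge0// ltW.
  have zx j : 0 <= `|z j| / x j by rewrite divr_ge0.
  apply: (@le_trans _ _ ((v k * \sum_(0 <= j < m k | J k j) (b j / S k) * (`|z j| / x j)) `^ s)).
    by rewrite powR_le// mulr_ge0// sumr_ge0// => j _; rewrite mulr_ge0.
  rewrite powRM//; last by rewrite sumr_ge0// => j _; rewrite mulr_ge0.
  apply: (@le_trans _ _ (v k `^ s *
    (2 `^ s * \sum_(0 <= j < m k | J k j) (b j / S k) * (`|z j| / x j) `^ s))).
    rewrite ler_wpM2l ?powR_ge0//; apply: weighted_mean_le => //.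
    by rewrite -mulr_suml -/(S k) divff ?gt_eqF.
  apply: (@le_trans _ _ (v k `^ s *
    (2 `^ s * ((S k)^-1 * \sum_(0 <= j < m k | J k j) `|z j| `^ s)))).
    rewrite ler_wpM2l ?powR_ge0// ler_wpM2l ?powR_ge0// mulr_sumr; apply: ler_sum => j _.
    have [xz|xz] := eqVneq (x j) 0.
      by rewrite (bx j xz) !mul0r mulr_ge0 ?powR_ge0// invr_ge0 ltW.
    rewrite mulrAC [leRHS]mulrC; apply: ler_wpM2r; first by rewrite invr_ge0 ltW.
    rewrite /b -powRM// mulrC divfK//.
  rewrite mulrCA -!mulrA ler_wpM2l ?powR_ge0// !mulrA ler_wpM2r//.
    by apply: sumr_ge0 => j _; exact: powR_ge0.
  by rewrite va ler_pdivrMr//; have := ler_wpM2l (ltW C0) Sk; lra.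
have D0 : 0 < 2 `^ s * (4 * C) by rewrite !mulr_gt0// powR_gt0.
apply: interpolation_lin => //; first exact: block_sum_lin.
  apply: block_sum_bounded D0 Jdisj blockD => //.
  by move: p_lt_q; rewrite qs lte_fin; exact: ltW.
by rewrite qs; apply: block_sum_bounded D0 Jdisj blockD.
Qed.

End operators_act.

Section sorted.
Variables (x y : nat -> R) (c0 : R).
Hypotheses (x0 : forall k, 0 <= x k) (xmono : forall k l, (k <= l)%N -> x l <= x k).
Hypotheses (y0 : forall k, 0 <= y k) (ymono : forall k l, (k <= l)%N -> y l <= y k).
Hypotheses (c00 : 0 < c0) (Kyx : forall t, 0 < t -> (K t y <= c0%:E * K t x)%E).

(** The bounds say that [x] splits at [n] in a way that is efficient for
    [t = n ^ (1 / p) / tau], so that [y] has a decomposition that is as efficient. *)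
Lemma transferred_decomposition n (L tau : R) : (0 < n)%N -> 0 < L -> 0 < tau ->
  \sum_(0 <= k < n) x k `^ p <= n%:R * L `^ p ->
  lp_le q (fun k => if (k < n)%N then 0 else x k) (tau * L) ->
  exists a b, [/\ y = a + b, lp_le p%:E a (3 * c0 * (n%:R `^ p^-1 * L)) &
    lp_le q b (3 * c0 * (tau * L))].
Proof.
move=> n0 L0 tau0 xp xq; pose nu : R := n%:R `^ p^-1.
have nu0 : 0 < nu by rewrite powR_gt0// ltr0n.
pose t := nu / tau; have t0 : 0 < t by rewrite divr_gt0.
have nuL : 0 < nu * L by rewrite mulr_gt0.
have Kx : (K t x <= (2 * (nu * L))%:E)%E.
  have -> : x = (fun k => if (k < n)%N then x k else 0) + (fun k => if (k < n)%N then 0 else x k).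
    by apply/funext => k; rewrite [RHS]/GRing.add/=; case: ifP; rewrite ?addr0 ?add0r.
  have -> : 2 * (nu * L) = nu * L + t * (tau * L).
    by rewrite /t; field; rewrite gt_eqF.
  apply: Kfun_le; first exact: ltW.
    apply/lp_leP => //; first exact: ltW.
    have -> : nu * L = (n%:R * L `^ p) `^ p^-1.
      by rewrite powRM ?powR_ge0// -powRrM mulfV ?gt_eqF// powRr1// ltW.
    apply: lp_le_root => // [|m]; first by rewrite mulr_ge0 ?powR_ge0.
    apply: le_trans xp; have [mn|/ltnW nm] := leqP m n.
      apply: le_trans (sum_mono (fun k => powR_ge0 (x k) p) mn).
      rewrite big_nat [leRHS]big_nat; apply: ler_sum => k /andP[_ km].
      by rewrite (leq_trans km mn) ger0_norm.
    rewrite (big_cat_nat (n:=n) (p:=m))//= [X in _ + X](_ : _ = 0) ?addr0; last first.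
      rewrite big_nat big1// => k /andP[nk _].
      by rewrite ltnNge nk normr0 powR0 ?gt_eqF.
    rewrite big_nat [leRHS]big_nat; apply: ler_sum => k /andP[_ kn].
    by rewrite kn ger0_norm.
  by apply/lp_leP => //; rewrite mulr_ge0// ltW.
have : (K t y < (3 * c0 * (nu * L))%:E)%E.
  apply: le_lt_trans (Kyx t0) _; apply: le_lt_trans (lee_wpmul2l _ Kx) _.
    by rewrite lee_fin ltW.
  by rewrite -EFinM lte_fin; have := mulr_gt0 c00 nuL; lra.
move=> /(Kfun_lt NpP NqP)[a [b [c [d [yab ac bd [c0' d0] cd]]]]].
exists a, b; split=> //; apply/lp_leP => //; rewrite ?ac ?bd ?lee_fin.
- by rewrite !mulr_ge0// ltW.
- by rewrite -/nu; have := mulr_ge0 (ltW t0) d0; lra.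
- by rewrite !mulr_ge0// ltW.
- have : t * d <= t * (3 * c0 * (tau * L)).
    have -> : t * (3 * c0 * (tau * L)) = 3 * c0 * (nu * L).
      by rewrite /t; field; rewrite gt_eqF.
    by apply: ltW; apply: le_lt_trans cd; rewrite lerDr.
  by rewrite ler_pM2l.
Qed.

Lemma scaled_sum (r M nu L : R) (a : nat -> R) m : 0 < r -> 0 < L -> 0 <= M -> 0 <= nu ->
  \sum_(0 <= k < m) `|a k| `^ r <= (M * (nu * L)) `^ r ->
  \sum_(0 <= k < m) `|a k / L| `^ r <= M `^ r * nu `^ r.
Proof.
move=> r0 L0 M0 nu0; have Lr : 0 < L `^ r by rewrite powR_gt0.
rewrite !powRM ?mulr_ge0 ?(ltW L0)// mulrA => H.
rewrite -(ler_pM2r Lr); apply: le_trans H; rewrite mulr_suml le_eqVlt; apply/orP; left; apply/eqP.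
apply: eq_bigr => k _; rewrite -powRM ?normr_ge0 ?(ltW L0)//.
by rewrite normf_div (gtr0_norm L0) divfK ?gt_eqF.
Qed.

Lemma scaled_sum_le (r L C : R) (z : nat -> R) n m N : 0 < L -> (forall k, 0 <= z k) ->
  \sum_(n <= k < m) (z k / L) `^ r <= C * N -> \sum_(n <= k < m) z k `^ r <= C * (N * L `^ r).
Proof.
move=> L0 z0 H; have Lr : 0 < L `^ r by rewrite powR_gt0.
rewrite mulrA -ler_pdivrMr//; apply: le_trans H; rewrite mulr_suml le_eqVlt.
apply/orP; left; apply/eqP.
apply: eq_bigr => k _; apply: (mulIf (lt0r_neq0 Lr)).
by rewrite divfK ?gt_eqF// -powRM ?divr_ge0 ?(ltW L0)// divfK ?gt_eqF.
Qed.

(** With [t = n ^ (1 / p - 1 / q)], the K-functional compares the averages of order [p] over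
    the head and of order [q] over the tail, both normalized by [n], to one level [L].
    So the level of [y] is at most a multiple of that of [x]. *)
Lemma power_sum_transfer : exists2 C : R, 0 < C &
  forall n (L tau : R), (0 < n)%N -> 0 < L -> 0 < tau ->
  (forall s, q = s%:E -> tau = n%:R `^ s^-1) -> (q = +oo%E -> tau = 1) ->
  \sum_(0 <= k < n) x k `^ p <= n%:R * L `^ p ->
  lp_le q (fun k => if (k < n)%N then 0 else x k) (tau * L) ->
  \sum_(0 <= k < n) y k `^ p <= C * (n%:R * L `^ p) /\
  forall s, q = s%:E -> forall m, \sum_(n <= k < m) y k `^ s <= C * (n%:R * L `^ s).
Proof.
(* For [q = +oo] any exponent above [p] serves to state the bound on the head of [b]. *)
pose s := if q is r%:E then r else p + 1.
have ps : p < s.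
  by move: p_lt_q; rewrite /s; case: (q) => [r||]//; rewrite ?lte_fin// => _; rewrite ltrDl.
have s0 : 0 < s by exact: lt_trans ps.
pose M0 := 3 * c0; have M00 : 0 < M0 by rewrite mulr_gt0.
pose M := M0 `^ p + M0 `^ s; have M_gt0 : 0 < M by rewrite addr_gt0 ?powR_gt0.
have [C1 C10 H1] := head_sum_bound p_gt0 ps M_gt0.
have [C2 C20 H2] := tail_sum_bound p_gt0 ps M_gt0.
exists (C1 + C2); first exact: addr_gt0.
move=> n L tau n0 L0 tau0 tauE tauy xp xq.
have [a [b [yab al bl]]] := transferred_decomposition n0 L0 tau0 xp xq.
have yab' k : y k / L <= `|a k / L| + `|b k / L|.
  have -> : y k = a k + b k by rewrite yab.
  by rewrite mulrDl; apply: le_trans (ler_norm _) (ler_normD _ _).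
have yL0 k : 0 <= y k / L by rewrite divr_ge0// ltW.
have yLmono k l : (k <= l)%N -> y l / L <= y k / L.
  by move=> kl; rewrite ler_wpM2r ?invr_ge0 ?(ltW L0)// ymono.
have ap m : \sum_(0 <= k < m) `|a k / L| `^ p <= M * n%:R.
  have := scaled_sum p_gt0 L0 (ltW M00) (powR_ge0 _ _) (al m).
  rewrite -powRrM mulVf ?gt_eqF// powRr1// => H; apply: le_trans H _.
  by rewrite ler_wpM2r// lerDl powR_ge0.
have bq m : (forall r, q = r%:E -> True) -> (q = +oo%E -> m = n) ->
    \sum_(0 <= k < m) `|b k / L| `^ s <= M * n%:R.
  move=> _ mn; apply: (@le_trans _ _ (M0 `^ s * n%:R)); last first.
    by rewrite ler_wpM2r// lerDr powR_ge0.
  have := p_lt_q; case qE : q => [r||] // _.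
    have sr : s = r by rewrite /s qE.
    rewrite qE -sr in bl; have tE : tau = n%:R `^ s^-1 by rewrite sr; exact: tauE.
    have := scaled_sum s0 L0 (ltW M00) (ltW tau0) (bl m).
    by rewrite tE -powRrM mulVf ?gt_eqF// powRr1.
  rewrite qE in bl; rewrite (mn qE) mulrC.
  apply: (@le_trans _ _ (\sum_(0 <= k < n) M0 `^ s)).
    apply: ler_sum => k _; rewrite powR_le ?(ltW M00)//.
    rewrite normf_div (gtr0_norm L0) ler_pdivrMr//.
    by have := bl k; rewrite (tauy qE) mul1r.
  by rewrite sumr_const_nat subn0 mulr_natl.
split.
  apply: (@scaled_sum_le p L) => //; apply: le_trans (H1 n _ _ _ yL0 yab' (ap n) _) _.
    by apply: bq.
  by rewrite ler_wpM2r// lerDl ltW.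
move=> r qr m; have sr : s = r by rewrite /s qr.
rewrite -sr; apply: (@scaled_sum_le s L) => //.
apply: le_trans (H2 n _ _ _ n0 yL0 yLmono yab' ap _ m) _.
  by move=> m'; apply: bq => //; rewrite qr.
by rewrite ler_wpM2r// lerDr ltW.
Qed.

(** For [q = +oo] an entry of a sorted sequence is at most the average of order [p] of the
    entries before it: the whole of [y] is majorized in the head. *)
Lemma sorted_act_infty NX : sequence_lattice NX -> interpolation_space Np Nq NX ->
  q = +oo%E -> 0 < x 0%N -> (NX x < +oo)%E -> (NX y < +oo)%E.
Proof.
move=> XP Xint qy x00 xfin; have [C C0 HC] := power_sum_transfer.
have P n : (0 < n)%N -> \sum_(0 <= k < n) y k `^ p <= C * \sum_(0 <= k < n) x k `^ p.
  move=> n0; pose S := \sum_(0 <= k < n) x k `^ p.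
  have n0' : (0 : R) < n%:R by rewrite ltr0n.
  have S0 : 0 < S.
    rewrite /S -(prednK n0) big_nat_recl//= ltr_pwDl ?powR_gt0// sumr_ge0// => k _.
    exact: powR_ge0.
  pose L := (S / n%:R) `^ p^-1; have L0 : 0 < L by rewrite powR_gt0// divr_gt0.
  have LE : n%:R * L `^ p = S.
    rewrite /L -powRrM mulVf ?gt_eqF// powRr1; last by rewrite ltW// divr_gt0.
    by rewrite mulrC divfK// gt_eqF.
  have [||||+ _] := HC n L 1 n0 L0 ltr01; rewrite ?LE//.
    by move=> s; rewrite qy.
  rewrite qy => k /=; case: ifP => kn; first by rewrite normr0 mul1r ltW.
  rewrite mul1r ger0_norm// -(powR_le p_gt0) ?(ltW L0)//.
  rewrite -(ler_pM2l n0') LE; apply: sum_const_le => i i_n.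
  by rewrite powR_le// xmono// (leq_trans (ltnW i_n))// leqNgt kn.
apply: (@head_majorized_act _ XP Xint x y C) => // [[|n]|k].
- by rewrite !big_geq// mulr0.
- exact: P.
- apply: le_trans (P k.+1 _) => //; apply: sum_const_le => i ik.
  by rewrite powR_le// ymono.
Qed.

(** Call [n] good ([G n]) if at [n] the level of [x] is that of its head, and bad if it is
    that of its tail. The head sums of [y] are below those of [x] at the good indices,
    the tail sums at the bad ones. Therefore the part of [y] on the good indices is
    majorized in the head at all indices (the last good index before [n] decides), and
    the part on the bad ones is majorized in the tail (the first bad index from [n] on
    decides). *)
Lemma sorted_act_finite NX (s : R) : sequence_lattice NX -> interpolation_space Np Nq NX ->
  q = s%:E -> 1 <= s -> 0 < x 0%N -> (sigma x < +oo)%E -> (NX x < +oo)%E -> (NX y < +oo)%E.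
Proof.
move=> XP Xint qs s1 x00 xsig xfin; have [C1 C10 HC1] := power_sum_transfer.
have s0 : 0 < s by exact: lt_le_trans s1.
have ps : p < s by move: p_lt_q; rewrite qs lte_fin.
have [C2 C20 HC2] := lq_of_sigma.
have [X X0 xX] : exists2 X : R, 0 <= X & lp_le q x X.
  move: xsig; rewrite sigmaE => /(ge0_is_fin_num (Kfun_ge0 NpP NqP _ ler01))[c c_0 xc].
  exists (C2 * (c + 1)); first by rewrite mulr_ge0 ?addr_ge0// ltW.
  by apply: HC2; rewrite ?addr_ge0// xc lte_fin ltrDl.
have xs0 k : 0 <= x k `^ s by exact: powR_ge0.
have xX' n : \sum_(0 <= k < n) x k `^ s <= X `^ s.
  have := xX; rewrite qs => /(_ n); congr (_ <= _); apply: eq_bigr => k _.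
  by rewrite ger0_norm.
have [Q [QS Q0 Qlim _]] := tail_sums xs0 xX'.
have xQ n m : \sum_(n <= k < m) x k `^ s <= Q n by apply: tail_sum_le.
have Qmono n m : (n <= m)%N -> Q m <= Q n.
  move=> /subnKC <-; elim: (m - n)%N => [|l IH]; first by rewrite addn0.
  by rewrite addnS; apply: le_trans IH; rewrite (QS (n + l)%N) lerDr.
pose P n := \sum_(0 <= k < n) x k `^ p.
have P0 n : (0 < n)%N -> 0 < P n.
  move=> n0; rewrite /P -(prednK n0) big_nat_recl//= ltr_pwDl ?powR_gt0// sumr_ge0// => k _.
  exact: powR_ge0.
have Pmono n : P n <= P n.+1 by rewrite /P big_nat_recr//= lerDl powR_ge0.
have tail_le n L : (0 < n)%N -> 0 <= L -> Q n <= n%:R * L `^ s ->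
    lp_le q (fun k => if (k < n)%N then 0 else x k) (n%:R `^ s^-1 * L).
  move=> n0 L0 QL; rewrite qs.
  have -> : n%:R `^ s^-1 * L = (n%:R * L `^ s) `^ s^-1.
    by rewrite powRM ?powR_ge0// -powRrM mulfV ?gt_eqF// powRr1.
  apply: lp_le_root => // [|m]; first by rewrite mulr_ge0 ?powR_ge0.
  apply: le_trans QL; apply: le_trans (xQ n m).
  have [nm|/ltnW mn] := leqP n m; last first.
    rewrite [leRHS]big_geq// big_nat big1// => k /andP[_ km].
    by rewrite (leq_trans km mn) normr0 powR0 ?gt_eqF.
  rewrite (big_cat_nat (n:=n) (p:=m))//= [X in X + _](_ : _ = 0) ?add0r; last first.
    by rewrite big_nat big1// => k /andP[_ kn]; rewrite kn normr0 powR0 ?gt_eqF.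
  rewrite big_nat [leRHS]big_nat; apply: ler_sum => k /andP[nk _].
  by rewrite ltnNge nk ger0_norm.
pose Lp n := (P n / n%:R) `^ p^-1.
have LpE n : (0 < n)%N -> n%:R * Lp n `^ p = P n.
  move=> n0; have n0' : (0 : R) < n%:R by rewrite ltr0n.
  rewrite /Lp -powRrM mulVf ?gt_eqF// powRr1; last by rewrite ltW// divr_gt0// P0.
  by rewrite mulrC divfK// gt_eqF.
have Lp0 n : (0 < n)%N -> 0 < Lp n by move=> n0; rewrite powR_gt0// divr_gt0 ?ltr0n// P0.
pose G n := (0 < n)%N && (Q n <= n%:R * Lp n `^ s).
have headG n : G n -> \sum_(0 <= k < n) y k `^ p <= C1 * P n.
  move=> /andP[n0 QL]; have [|||||+ _] := HC1 n (Lp n) (n%:R `^ s^-1) n0 (Lp0 n n0).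
  - by rewrite powR_gt0// ltr0n.
  - by move=> s'; rewrite qs => -[->].
  - by rewrite qs.
  - by rewrite LpE.
  - by apply: tail_le => //; exact: ltW (Lp0 n n0).
  - by rewrite LpE.
pose C3 := (C2 * ((c0 + 1) * X)) `^ s / Q 0%N.
have Q00 : 0 < Q 0%N by rewrite QS ltr_pwDl ?powR_gt0.
have X_gt0 : 0 < X.
  rewrite lt_neqAle X0 andbT eq_sym; apply/eqP => Xz.
  have := lp_le_coord 0%N q_gt0 X0 xX; rewrite Xz normr_le0 => /eqP xz.
  by move: x00; rewrite xz ltxx.
have C30 : 0 <= C3 by rewrite divr_ge0 ?powR_ge0// ltW.
have C130 : 0 < C1 + C3 by rewrite ltr_pwDl.
have tailB n : ~~ G n -> forall m, \sum_(n <= k < m) y k `^ s <= (C1 + C3) * Q n.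
  (* At [n = 0] the bound is that of the [l^s] quasi-norm, i.e. of the K-functional at [1]. *)
  rewrite /G negb_and -leqNgt leqn0; case: eqVneq => [-> _ m|n0 /= QL m].
    apply: (@le_trans _ _ (C3 * Q 0%N)); last by rewrite ler_wpM2r// lerDr ltW.
    rewrite divfK ?gt_eqF//; have K1x : (K 1 x <= X%:E)%E.
      rewrite -[x in K 1 x]add0r.
      apply: le_trans (@Kfun_le _ Np Nq 1 0 x 0 X ler01 _ _) _; last by rewrite mul1r add0r.
        by have := lqn_scale NpP 0 0; rewrite scale0r normr0 mul0e.
      exact/lp_leP.
    have Ky : (K 1 y < ((c0 + 1) * X)%:E)%E.
      apply: le_lt_trans (Kyx ltr01) _; apply: le_lt_trans (lee_wpmul2l _ K1x) _.
        by rewrite lee_fin ltW.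
      by rewrite -EFinM lte_fin ltr_pM2r// ltrDl.
    have H := HC2 y _ (mulr_ge0 (addr_ge0 (ltW c00) ler01) X0) Ky.
    rewrite qs in H; apply: le_trans (H m); apply: ler_sum => k _; by rewrite ger0_norm.
  move: QL; rewrite -ltNge => QL; have {}n0 : (0 < n)%N by rewrite lt0n.
  have n0' : (0 : R) < n%:R by rewrite ltr0n.
  pose L := (Q n / n%:R) `^ s^-1.
  have Qn0 : 0 <= Q n / n%:R by rewrite divr_ge0.
  have LE : n%:R * L `^ s = Q n.
    rewrite /L -powRrM mulVf ?gt_eqF// powRr1//.
    by rewrite mulrC divfK// gt_eqF.
  have Ls0 : 0 <= L by exact: powR_ge0.
  have LpL : Lp n < L.
    rewrite ltNge; apply/negP => H; move: QL; rewrite -LE ltNge => /negP; apply.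
    by rewrite (ler_pM2l n0') (powR_le s0 Ls0 (ltW (Lp0 n n0))).
  have L0 : 0 < L by apply: lt_trans LpL; exact: Lp0.
  have [|||||_ +] := HC1 n L (n%:R `^ s^-1) n0 L0.
  - by rewrite powR_gt0.
  - by move=> s'; rewrite qs => -[->].
  - by rewrite qs.
  - apply: (@le_trans _ _ (n%:R * Lp n `^ p)); first by have -> := LpE n n0.
    by rewrite (ler_pM2l n0') (powR_le p_gt0 (ltW (Lp0 n n0)) Ls0) (ltW LpL).
  - by apply: tail_le => //; rewrite LE.
  move=> /(_ s qs m); rewrite LE => /le_trans; apply.
  by rewrite ler_wpM2r// lerDl.
pose u k := if G k then y k else 0; pose v k := if G k then 0 else y k.
have u0 k : 0 <= u k by rewrite /u; case: ifP.
have v0 k : 0 <= v k by rewrite /v; case: ifP.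
have uy k : u k <= y k by rewrite /u; case: ifP.
have -> : y = u + v.
  by apply/funext => k; rewrite [RHS]/GRing.add/= /u /v; case: ifP; rewrite ?addr0 ?add0r.
have yk k : G k -> k.+1%:R * y k `^ p <= 2 * C1 * P k.
  move=> Gk; have /andP[k0 _] := Gk; have H := headG k Gk.
  have : k%:R * y k `^ p <= C1 * P k.
    by apply: le_trans H; apply: sum_const_le => i ik; rewrite powR_le// ymono// ltnW.
  have : y k `^ p <= k%:R * y k `^ p by rewrite ler_peMl ?powR_ge0// ler1n.
  by rewrite -natr1 mulrDl mul1r; lra.
have NXq := proj1 (proj1 XP); have [Nge _ _ [CX [_ HX]]] := NXq.
suff [H1 H2] : (NX u < +oo)%E /\ (NX v < +oo)%E.
  apply: le_lt_trans (HX _ _) _.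
  have [d1 _ ->] := ge0_is_fin_num (Nge _) H1; have [d2 _ ->] := ge0_is_fin_num (Nge _) H2.
  by rewrite -EFinD -EFinM ltry.
split.
  apply: (@head_majorized_act _ XP Xint x u (2 * C1)) => //; first exact: mulr_gt0.
  - elim=> [|n IH]; first by rewrite !big_geq// mulr0.
    rewrite big_nat_recr//=; rewrite {2}/u; case: ifPn => [Gn|_]; last first.
      rewrite powR0 ?gt_eqF// addr0; apply: le_trans IH _.
      by rewrite ler_pM2l ?mulr_gt0//; exact: Pmono.
    have H := headG n Gn; have /andP[n0 _] := Gn.
    have H2 : \sum_(0 <= k < n) u k `^ p <= \sum_(0 <= k < n) y k `^ p.
      by apply: ler_sum => k _; rewrite powR_le.
    have H3 : y n `^ p <= C1 * P n.
      apply: le_trans H; apply: (@le_trans _ _ (n%:R * y n `^ p)).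
        by rewrite ler_peMl ?powR_ge0// ler1n.
      by apply: sum_const_le => i i_n; rewrite powR_le// ymono// ltnW.
    have H4 : 2 * C1 * P n <= 2 * C1 * P n.+1 by rewrite ler_pM2l ?mulr_gt0.
    by rewrite -/(P n.+1); lra.
  - move=> k; rewrite /u; case: ifPn => [Gk|_].
      by apply: le_trans (yk k Gk) _; rewrite ler_pM2l ?mulr_gt0//; exact: Pmono.
    rewrite powR0 ?gt_eqF// mulr0; apply: mulr_ge0; first by rewrite mulr_ge0// ltW.
    by apply: sumr_ge0 => i _; exact: powR_ge0.
apply: (@tail_majorized_act _ XP Xint s x v Q (C1 + C3)) => //.
move=> n m; have [l ml] : exists l, (m <= n + l)%N by exists m; exact: leq_addl.
elim: l n ml => [|l IH] n; first by rewrite addn0 => mn; rewrite big_geq// mulr_ge0// ltW.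
rewrite addnS -addSn => ml; have [nm|mn] := ltnP n m; last by rewrite big_geq// mulr_ge0// ltW.
have [Gn|Gn] := boolP (G n).
  rewrite big_ltn//= {1}/v Gn powR0 ?gt_eqF// add0r; apply: le_trans (IH _ ml) _.
  by rewrite ler_pM2l// Qmono.
apply: le_trans (tailB n Gn m); apply: ler_sum => k _; rewrite powR_le//.
by rewrite /v; case: ifP.
Qed.
End sorted.

(** If [K t y <= K t x] for all [t], the sorted version of [y] is the sum of images of
    that of [x] under operators bounded on the couple, and sorting itself is done by such
    operators; so [y] belongs to every interpolation space that contains [x]. *)
Lemma K_monotone_of_interpolation NX : (1 <= q)%E -> sequence_lattice NX ->
  interpolation_space Np Nq NX -> K_monotone Np Nq NX.
Proof.
move=> q1 XP Xint; have [_ Xi _] := Xint; have NXq := proj1 (proj1 XP).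
split=> // x y xfin ysig Kyx.
have [c c0 xc] := Kfun_fin NpP NqP XP Xi ler01 xfin.
have [|xt [f1 [r1 [f2 [r2 [[xt0 xtmono] xtE xE Hx]]]]]] := @almost_sorted _ x c.
  by move=> k; rewrite -lee_fin -xc -sigmaE; exact: sigma_coord.
have [d d0 yd] : exists2 d : R, 0 <= d & K 1 y = d%:E.
  by move: ysig; rewrite sigmaE; apply: ge0_is_fin_num; exact: Kfun_ge0.
have [|yt [g1 [w1 [g2 [w2 [[yt0 ytmono] ytE yE Hy]]]]]] := @almost_sorted _ y d.
  by move=> k; rewrite -lee_fin -yd -sigmaE; exact: sigma_coord.
have [Hx1 Hx2] := Hx p p_gt0; have [Hy1 Hy2] := Hy p p_gt0.
have xtfin : (NX xt < +oo)%E by rewrite xtE; apply: reindex_act Hx1 _.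
have KD f w (C : R) : (forall j m, \sum_(0 <= k < m | f k == j) `|w k| `^ p <= C) ->
    exists2 D : R, 0 < D & forall t z, 0 <= t -> (K t (weighted_reindex f w z) <= D%:E * K t z)%E.
  move=> wC; apply: Kfun_bounded; first exact: weighted_reindex_lin.
    exact: weighted_reindex_bounded wC.
  exact: weighted_reindex_bounded (ltW p_lt_q) wC.
have [D1 D10 HD1] := KD _ _ _ Hx2; have [D2 D20 HD2] := KD _ _ _ Hy1.
have Kt t : 0 < t -> (K t yt <= (D2 * D1)%:E * K t xt)%E.
  move=> t0; have t0' := ltW t0; rewrite {1}ytE; apply: le_trans (HD2 t y t0') _.
  rewrite EFinM -muleA; apply: lee_wpmul2l; first by rewrite lee_fin ltW.
  apply: le_trans (Kyx t t0) _; rewrite {1}xE; exact: HD1.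
have D0 : 0 < D2 * D1 by rewrite mulr_gt0.
suff ytfin : (NX yt < +oo)%E by rewrite yE; apply: reindex_act Hy2 ytfin.
have [xz|xz] := eqVneq (xt 0%N) 0.
  have xt_eq0 : xt = 0.
    apply/funext => k; apply/le_anti/andP; split; last exact: xt0.
    by have := xtmono 0%N k (leq0n k); rewrite xz.
  have K0 : (K 1 (0 : nat -> R) <= 0%E)%E.
    rewrite -[X in K 1 X]addr0.
    apply: le_trans (@Kfun_le _ Np Nq 1 0 0 0 0 ler01 _ _) _; last by rewrite mulr0 addr0.
      by have := lqn_scale NpP 0 0; rewrite scale0r normr0 mul0e.
    by have := lqn_scale NqP 0 0; rewrite scale0r normr0 mul0e.
  suff -> : yt = 0 by rewrite (qnorm0 NXq) ltry.
  apply/funext => k; apply/eqP; rewrite -normr_le0 -lee_fin.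
  apply: le_trans (sigma_coord NpP NqP yt k) _; rewrite sigmaE.
  apply: le_trans (Kt 1 ltr01) _; rewrite xt_eq0.
  by apply: le_trans (lee_wpmul2l _ K0) _; rewrite ?mule0// lee_fin ltW.
have xt0' : 0 < xt 0%N by rewrite lt_neqAle eq_sym xz xt0.
case qE : q => [s||].
- apply: (@sorted_act_finite xt yt (D2 * D1) xt0 xtmono yt0 ytmono D0 Kt NX s) => //.
    by move: q1; rewrite qE lee_fin.
  exact: (sigma_fin XP Xi xtfin).
- exact: (@sorted_act_infty xt yt (D2 * D1) xt0 xtmono yt0 ytmono D0 Kt NX).
- by move: q1; rewrite qE.
Qed.
End Calderon_Mityagin.

Local Open Scope ereal_scope.

Theorem theorem8p1 (R : realType) (p q : \bar R) (p_gt0 : 0 < p) (p_lt_q : p < q) :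
  (forall NX : (nat -> R) -> \bar R,
     sequence_lattice NX ->
     K_monotone (lp_qnorm p) (lp_qnorm q) NX ->
     K_space (lp_qnorm p) (lp_qnorm q) NX) /\
  (1 <= q ->
   forall NX : (nat -> R) -> \bar R,
     sequence_lattice NX ->
     interpolation_space (lp_qnorm p) (lp_qnorm q) NX ->
     K_space (lp_qnorm p) (lp_qnorm q) NX).
Proof.
have H NX : sequence_lattice NX -> K_monotone (lp_qnorm p) (lp_qnorm q) NX ->
    K_space (lp_qnorm p) (lp_qnorm q) NX.
  move=> XP Xmon; have [Xint _] := Xmon; apply: K_space_of_K_monotone => //.
    exact: lp_lattice_qnorm.
  by apply: lp_lattice_qnorm; exact: lt_trans p_lt_q.
split=> // q1 NX XP Xint; apply: H => //.
case: p p_gt0 p_lt_q Xint => [r||]// r0 rq Xint; last by case: q rq Xint {q1}.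
by apply: K_monotone_of_interpolation.
Qed.
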